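(* Let $N,M,n\geqslant 1$. Under the homomorphism $\mathrm U(\mathfrak q_N)\to\mathcal{PD}$ given by $G\mapsto XD$ (applied to the last tensor factor of $Q_N^{\otimes n}\otimes \mathrm U(\mathfrak q_N)$), we have $$(G_1+M^{(1)})\cdots(G_n+M^{(n)})\ \mapsto\ X_1\cdots X_n\,D_1\cdots D_n ,$$ an equality of elements of $Q_N^{\otimes n}\otimes\mathcal{PD}$.
   Context: All algebras are over $\mathbb C$; tensor products of superalgebras (and of superspaces with products) are graded: $(a\otimes b)(c\otimes d)=(-1)^{\deg b\deg c}\,ac\otimes bd$. Here $\mathrm i=\sqrt{-1}$. $\mathfrak q_N$ and $Q_N$. $\mathbb C^{N|N}$ has basis $e_{-N},\dots,e_{-1},e_1,\dots,e_N$ with $e_i$ odd for $i<0$, even for $i>0$. $E_{ij}$ are the matrix units, also viewed as a basis of $\mathfrak{gl}_{N|N}$. The queer Lie superalgebra $\mathfrak q_N\subset\mathfrak{gl}_{N|N}$ is spanned by $F_{ij}=E_{ij}+E_{-i,-j}$ (so $F_{-i,-j}=F_{ij}$). The associative superalgebra $Q_N\subset \mathrm{End}\,\mathbb C^{N|N}$ has basis $e_{kl}=E_{kl}+E_{-k,-l}$ (even) and $f_{kl}=E_{k,-l}+E_{-k,l}$ (odd), $k,l=1,\dots,N$. Put $G=\sum_{k,l=1}^N\big(e_{kl}\otimes F_{l,-k}-f_{kl}\otimes F_{lk}\big)\in Q_N\otimes\mathrm U(\mathfrak q_N)$, and, in $Q_N^{\otimes n}\otimes\mathrm U(\mathfrak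 q_N)$, $$G_a=\sum_{k,l=1}^N\big(1^{\otimes(a-1)}\otimes e_{kl}\otimes1^{\otimes(n-a)}\otimes F_{l,-k}-1^{\otimes(a-1)}\otimes f_{kl}\otimes1^{\otimes(n-a)}\otimes F_{lk}\big),\quad a=1,\dots,n.$$ For $1\le a<b\le n$, $$T_{ab}=\sum_{k,l=1}^N\big(1^{\otimes(a-1)}\otimes f_{kl}\otimes1^{\otimes(b-a-1)}\otimes e_{lk}\otimes1^{\otimes(n-b)}-1^{\otimes(a-1)}\otimes e_{kl}\otimes1^{\otimes(b-a-1)}\otimes f_{lk}\otimes1^{\otimes(n-b)}\big)\in Q_N^{\otimes n},$$ and $M^{(1)}=0$, $M^{(b)}=T_{1b}+\dots+T_{b-1,b}$ for $b=2,\dots,n$, identified with $M^{(b)}\otimes1$. (The $M^{(b)}$ are the images of the odd Jucys–Murphy elements of the Sergeev superalgebra, multiplied by $\sqrt2$.) Differential operators. $\mathcal P$ is the supercommutative superalgebra with generators $x_{ak}$, $a\in\{-M,\dots,-1,1,\dots,M\}$, $k\in\{1,\dots,N\}$, of parity $\bar a$, where $\bar a=1$ for $a<0$ and $\bar a=0$ for $a>0$. $\partial_{ka}=\partial/\partial x_{ak}$ is the left derivation, of parity $\bar a$, and $\mathcal{PD}$ is the superalgebra of differential operators generated by the $x_{ak}$ and $\partial_{ka}$. The homomorphism $\mathrm U(\mathfrak q_N)\to\mathcal{PD}$ is given, for $k,l=1,\dots,N$, by $$F_{kl}\mapsto-\sum_{a=-M}^{M}x_{al}\partial_{ka},\qquad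 F_{k,-l}\mapsto \mathrm i\sum_{a=-M}^M x_{al}\partial_{k,-a}$$ (sums skip $a=0$). Matrices $X$ and $D$. Let $\mathrm{Hom}(\mathbb C^M,\mathbb C^{N|N})$ and $\mathrm{Hom}(\mathbb C^{N|N},\mathbb C^M)$ denote auxiliary superspaces with respective bases $\{e_{ka},f_{ka}\}$ and $\{e_{ak},f_{ak}\}$, $1\le a\le M$, $1\le k\le N$, where the $e$'s are even and the $f$'s are odd. The product map $\mathrm{Hom}(\mathbb C^M,\mathbb C^{N|N})\otimes\mathrm{Hom}(\mathbb C^{N|N},\mathbb C^M)\to Q_N$ is $$e_{ka}e_{bl}=\delta_{ab}e_{kl},\quad e_{ka}f_{bl}=\delta_{ab}f_{kl},\quad f_{ka}e_{bl}=\delta_{ab}f_{kl},\quad f_{ka}f_{bl}=\delta_{ab}e_{kl}.$$ Set $$X=\sum_{a=1}^M\sum_{k=1}^N\big(e_{ka}\otimes x_{ak}-\mathrm i\,f_{ka}\otimes x_{-a,k}\big),\qquad D=\sum_{a=1}^M\sum_{k=1}^N\big(\mathrm i\,e_{ak}\otimes\partial_{k,-a}+f_{ak}\otimes\partial_{ka}\big),$$ elements of $\mathrm{Hom}(\mathbb C^M,\mathbb C^{N|N})\otimes\mathcal{PD}$ (even) and $\mathrm{Hom}(\mathbb C^{N|N},\mathbb C^M)\otimes\mathcal{PD}$ (odd). In this notation the homomorphism $\mathrm U(\mathfrak q_N)\to\mathcal{PD}$ sending $F_{kl}\mapsto-\sum_{a}x_{al}\partial_{ka}$ and $F_{k,-l}\mapsto\mathrm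 i\sum_{a}x_{al}\partial_{k,-a}$ reads $G\mapsto XD\in Q_N\otimes\mathcal{PD}$. $X_r$ and $D_r$ denote $X$ and $D$ associated with the $r$-th copy of the respective Hom space in $\big(\mathrm{Hom}(\mathbb C^M,\mathbb C^{N|N})\otimes\mathrm{Hom}(\mathbb C^{N|N},\mathbb C^M)\big)^{\otimes n}$, and $X_1\cdots X_nD_1\cdots D_n$ is regarded as an element of $Q_N^{\otimes n}\otimes\mathcal{PD}$ by applying the product map in each of the $n$ factors (with the usual sign rule). *)

(* Defs.v *)
From HB Require Import structures.
From mathcomp Require Import all_boot all_order all_algebra.
From mathcomp Require Import boolp reals.
From mathcomp Require Import complex.

Set Implicit Arguments.
Unset Strict Implicit.
Unset Printing Implicit Defensive.

Import Order.TTheory GRing.Theory Num.Theory.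
Local Open Scope quotient_scope.
Local Open Scope ring_scope.

(* Z/2-gradings are encoded by the grading involution [sgn], which acts by     *)
(* (-1)^p on the component of parity p; in characteristic different from 2    *)
(* this is the same datum as the decomposition into even and odd parts.       *)
HB.mixin Record isSuperRing A of GRing.PzRing A := {
  sgn : A -> A;
  sgnD : {morph sgn : x y / x + y};
  sgnM : {morph sgn : x y / x * y};
  sgn1 : sgn 1 = 1;
  sgnK : involutive sgn
}.

#[short(type="superRingType")]
HB.structure Definition SuperRing := {A of GRing.PzRing A & isSuperRing A}.

HB.mixin Record isSuperLinear (C : pzRingType) A
    of GRing.Algebra C A & SuperRing A := {
  sgnZ : forall c : C, {morph (@sgn A) : x / c *: x}
}.

#[short(type="superAlgType")]
HB.structure Definition SuperAlgebra (C : pzRingType) :=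
  {A of GRing.Algebra C A & SuperRing A & isSuperLinear C A}.

Section SuperRingTheory.
Variable A : superRingType.
Implicit Types x y : A.

Lemma sgn0 : sgn (0 : A) = 0.
Proof. by apply: (addrI (sgn 0)); rewrite -sgnD !addr0. Qed.

Lemma sgnN x : sgn (- x) = - sgn x.
Proof. by apply: (addrI (sgn x)); rewrite -sgnD !subrr sgn0. Qed.

Lemma sgn_sum I (r : seq I) (P : pred I) (F : I -> A) :
  sgn (\sum_(i <- r | P i) F i) = \sum_(i <- r | P i) sgn (F i).
Proof. exact: (big_morph _ sgnD sgn0). Qed.

Definition homogeneous (p : bool) x := sgn x = (-1) ^+ p * x.

Lemma homogeneousM p q x y :
  homogeneous p x -> homogeneous q y -> homogeneous (p (+) q) (x * y).
Proof.
rewrite /homogeneous sgnM => -> ->.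
rewrite signr_addb; case: p q => [] [];
  by rewrite ?expr1 ?expr0 ?mulN1r ?mul1r ?mulrN ?mulNr ?mulN1r ?mul1r ?opprK.
Qed.

Definition sgnb (p : bool) x := if p then sgn x else x.

Lemma sgnb_homogeneous p q x :
  homogeneous q x -> sgnb p x = (-1) ^+ (p && q) * x.
Proof.
by rewrite /homogeneous /sgnb; case: p => /= [->|_]; rewrite ?mul1r.
Qed.

End SuperRingTheory.

Lemma homogeneous_decomposition (C : numFieldType) (A : superAlgType C) (x : A) :
  exists x0 x1 : A, [/\ homogeneous false x0, homogeneous true x1 & x = x0 + x1].
Proof.
exists (2^-1 *: (x + sgn x)), (2^-1 *: (x - sgn x)); split.
- by rewrite /homogeneous sgnZ sgnD sgnK mul1r addrC.
- by rewrite /homogeneous sgnZ sgnD sgnN sgnK mulN1r -scalerN opprB addrC.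
- rewrite -scalerDr addrACA subrr addr0 -mulr2n -scaler_nat scalerA.
  by rewrite mulVf ?scale1r // pnatr_eq0.
Qed.

(* Associative superalgebras with given generators are built as quotients of  *)
(* the algebra of terms in the generators.                                    *)
Section Terms.
Variables (C : numClosedFieldType) (G : Type).

Inductive term :=
  | Gen of G
  | Cst of C
  | Add of term & term
  | Mul of term & term.

HB.instance Definition _ := gen_eqMixin term.
HB.instance Definition _ := gen_choiceMixin term.

Variable par : G -> bool.

Fixpoint tsgn (t : term) : term :=
  match t with
  | Gen g => Mul (Cst ((-1) ^+ par g)) (Gen g)
  | Cst c => Cst c
  | Add s t => Add (tsgn s) (tsgn t)
  | Mul s t => Mul (tsgn s) (tsgn t)
  end.

Record alg_cong (e : term -> term -> Prop) : Prop := AlgCong {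
  ac_refl : forall s, e s s;
  ac_sym : forall s t, e s t -> e t s;
  ac_trans : forall s t u, e s t -> e t u -> e s u;
  ac_Add : forall s s' t t', e s s' -> e t t' -> e (Add s t) (Add s' t');
  ac_Mul : forall s s' t t', e s s' -> e t t' -> e (Mul s t) (Mul s' t');
  ac_addA : forall s t u, e (Add s (Add t u)) (Add (Add s t) u);
  ac_addC : forall s t, e (Add s t) (Add t s);
  ac_add0 : forall s, e (Add (Cst 0) s) s;
  ac_mulA : forall s t u, e (Mul s (Mul t u)) (Mul (Mul s t) u);
  ac_mul1 : forall s, e (Mul (Cst 1) s) s;
  ac_mul0 : forall s, e (Mul (Cst 0) s) (Cst 0);
  ac_mulDl : forall s t u, e (Mul (Add s t) u) (Add (Mul s u) (Mul t u));
  ac_mulDr : forall s t u, e (Mul u (Add s t)) (Add (Mul u s) (Mul u t));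
  ac_cstD : forall c d, e (Cst (c + d)) (Add (Cst c) (Cst d));
  ac_cstM : forall c d, e (Cst (c * d)) (Mul (Cst c) (Cst d));
  ac_central : forall c s, e (Mul (Cst c) s) (Mul s (Cst c));
  ac_tsgn : forall s t, e s t -> e (tsgn s) (tsgn t);
  ac_neq0 : ~ e (Cst 1) (Cst 0)
}.

Variables (e : term -> term -> Prop) (He : alg_cong e).

Definition erel : rel term := fun s t => `[< e s t >].

Lemma erel_refl : reflexive erel.
Proof. by move=> s; apply/asboolP/(ac_refl He). Qed.
Lemma erel_sym : symmetric erel.
Proof. by move=> s t; apply/asboolP/asboolP; apply: (ac_sym He). Qed.
Lemma erel_trans : transitive erel.
Proof.
by move=> s t u /asboolP h1 /asboolP h2; apply/asboolP/(ac_trans He h1 h2).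
Qed.

Definition eequiv := EquivRel erel erel_refl erel_sym erel_trans.

Definition talg : Type := {eq_quot eequiv}.

HB.instance Definition _ := Quotient.on talg.
HB.instance Definition _ := Choice.on talg.

Definition tpi (s : term) : talg := \pi_({eq_quot eequiv}) s.
Definition trepr (x : talg) : term := repr (x : {eq_quot eequiv}).

Lemma tpiP s t : tpi s = tpi t <-> e s t.
Proof.
by split=> [/eqP|h]; [rewrite /tpi eqmodE => /asboolP | apply/eqP; rewrite /tpi eqmodE; apply/asboolP].
Qed.

Lemma treprK x : tpi (trepr x) = x.
Proof. exact: reprK. Qed.

Lemma trepr_pi s : e (trepr (tpi s)) s.
Proof. by apply/tpiP; rewrite treprK. Qed.

Lemma talg_ind (P : talg -> Prop) : (forall s, P (tpi s)) -> forall x, P x.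
Proof. by move=> h x; rewrite -[x]treprK. Qed.

Definition tadd (x y : talg) := tpi (Add (trepr x) (trepr y)).
Definition tmul (x y : talg) := tpi (Mul (trepr x) (trepr y)).
Definition topp (x : talg) := tpi (Mul (Cst (-1)) (trepr x)).
Definition tscale (c : C) (x : talg) := tpi (Mul (Cst c) (trepr x)).
Definition tsg (x : talg) := tpi (tsgn (trepr x)).

Lemma taddE s t : tadd (tpi s) (tpi t) = tpi (Add s t).
Proof. by apply/tpiP/(ac_Add He); apply: trepr_pi. Qed.
Lemma tmulE s t : tmul (tpi s) (tpi t) = tpi (Mul s t).
Proof. by apply/tpiP/(ac_Mul He); apply: trepr_pi. Qed.
Lemma toppE s : topp (tpi s) = tpi (Mul (Cst (-1)) s).
Proof. by apply/tpiP/(ac_Mul He (ac_refl He _))/trepr_pi. Qed.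
Lemma tscaleE c s : tscale c (tpi s) = tpi (Mul (Cst c) s).
Proof. by apply/tpiP/(ac_Mul He (ac_refl He _))/trepr_pi. Qed.
Lemma tsgE s : tsg (tpi s) = tpi (tsgn s).
Proof. by apply/tpiP/(ac_tsgn He)/trepr_pi. Qed.

Let tE := (taddE, tmulE, toppE, tscaleE, tsgE).

Lemma taddA : associative tadd.
Proof.
elim/talg_ind=> s; elim/talg_ind=> t; elim/talg_ind=> u.
by rewrite !tE; apply/tpiP/(ac_addA He).
Qed.
Lemma taddC : commutative tadd.
Proof.
by elim/talg_ind=> s; elim/talg_ind=> t; rewrite !tE; apply/tpiP/(ac_addC He).
Qed.
Lemma tadd0 : left_id (tpi (Cst 0)) tadd.
Proof. by elim/talg_ind=> s; rewrite !tE; apply/tpiP/(ac_add0 He). Qed.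
Lemma taddN : left_inverse (tpi (Cst 0)) topp tadd.
Proof.
elim/talg_ind=> s; rewrite !tE -[X in Add _ X]/s.
have -> : tpi (Add (Mul (Cst (-1)) s) s) = tpi (Mul (Cst 0) s).
  rewrite -(addNr 1); apply/tpiP.
  apply: (ac_trans He); last first.
    by apply: (ac_Mul He (ac_sym He (ac_cstD He _ _)) (ac_refl He _)).
  apply: (ac_trans He); last by apply: (ac_sym He (ac_mulDl He _ _ _)).
  by apply: (ac_Add He (ac_refl He _)); apply: (ac_sym He (ac_mul1 He _)).
exact/tpiP/(ac_mul0 He).
Qed.

HB.instance Definition _ := GRing.isZmodule.Build talg taddA taddC tadd0 taddN.

Lemma tmulA : associative tmul.
Proof.
elim/talg_ind=> s; elim/talg_ind=> t; elim/talg_ind=> u.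
by rewrite !tE; apply/tpiP/(ac_mulA He).
Qed.
Lemma tmul1 : left_id (tpi (Cst 1)) tmul.
Proof. by elim/talg_ind=> s; rewrite !tE; apply/tpiP/(ac_mul1 He). Qed.
Lemma tmulr1 : right_id (tpi (Cst 1)) tmul.
Proof.
elim/talg_ind=> s; rewrite !tE; apply/tpiP.
exact: ac_trans (ac_sym He (ac_central He _ _)) (ac_mul1 He _).
Qed.
Lemma tmulDl : left_distributive tmul tadd.
Proof.
elim/talg_ind=> s; elim/talg_ind=> t; elim/talg_ind=> u.
by rewrite !tE; apply/tpiP/(ac_mulDl He).
Qed.
Lemma tmulDr : right_distributive tmul tadd.
Proof.
elim/talg_ind=> s; elim/talg_ind=> t; elim/talg_ind=> u.
by rewrite !tE; apply/tpiP/(ac_mulDr He).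
Qed.
Lemma tone_neq0 : tpi (Cst 1) != tpi (Cst 0).
Proof. by apply/eqP => /tpiP; apply: ac_neq0 He. Qed.

HB.instance Definition _ := GRing.Zmodule_isNzRing.Build talg
  tmulA tmul1 tmulr1 tmulDl tmulDr tone_neq0.

Lemma tpiD s t : tpi (Add s t) = tpi s + tpi t. Proof. by rewrite -taddE. Qed.
Lemma tpiM s t : tpi (Mul s t) = tpi s * tpi t. Proof. by rewrite -tmulE. Qed.

Lemma tscaleA c d x : tscale c (tscale d x) = tscale (c * d) x.
Proof.
elim/talg_ind: x => s; rewrite !tE !tpiM mulrA; congr (_ * _).
by rewrite -tpiM; apply/tpiP/(ac_sym He)/(ac_cstM He).
Qed.
Lemma tscale1 : left_id 1 tscale.
Proof. by elim/talg_ind=> s; rewrite tE; apply/tpiP/(ac_mul1 He). Qed.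
Lemma tscaleDr : right_distributive tscale +%R.
Proof.
move=> c; elim/talg_ind=> s; elim/talg_ind=> t.
by rewrite -tpiD !tE !tpiM -mulrDr tpiD.
Qed.
Lemma tscaleDl x : {morph tscale^~ x : c d / c + d}.
Proof.
move=> c d; elim/talg_ind: x => s; rewrite !tE !tpiM -mulrDl; congr (_ * _).
by rewrite -tpiD; apply/tpiP/(ac_cstD He).
Qed.

HB.instance Definition _ := GRing.Zmodule_isLmodule.Build C talg
  tscaleA tscale1 tscaleDr tscaleDl.

Lemma tpiZ c s : tpi (Mul (Cst c) s) = c *: tpi s.
Proof. by rewrite -tscaleE. Qed.

Lemma tscaleAl (c : C) (x y : talg) : c *: (x * y) = (c *: x) * y.
Proof.
elim/talg_ind: x => s; elim/talg_ind: y => t.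
by rewrite -tpiM -!tpiZ -tpiM !tpiM mulrA.
Qed.

HB.instance Definition _ := GRing.Lmodule_isLalgebra.Build C talg tscaleAl.

Lemma tscaleAr (c : C) (x y : talg) : c *: (x * y) = x * (c *: y).
Proof.
elim/talg_ind: x => s; elim/talg_ind: y => t.
rewrite -tpiM -!tpiZ -tpiM !tpiM !mulrA; congr (_ * _).
by rewrite -!tpiM; apply/tpiP/(ac_central He).
Qed.

HB.instance Definition _ := GRing.Lalgebra_isAlgebra.Build C talg tscaleAr.

Lemma tpi1 : tpi (Cst 1) = 1. Proof. by []. Qed.
Lemma tpiC c : tpi (Cst c) = c%:A.
Proof. by rewrite -tpi1 -tpiZ tpiM tpi1 mulr1. Qed.

Lemma tsgD : {morph tsg : x y / x + y}.
Proof.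
by elim/talg_ind=> s; elim/talg_ind=> t; rewrite -tpiD !tE -tpiD.
Qed.
Lemma tsgM : {morph tsg : x y / x * y}.
Proof.
by elim/talg_ind=> s; elim/talg_ind=> t; rewrite -tpiM !tE -tpiM.
Qed.
Lemma tsg1 : tsg 1 = 1. Proof. by rewrite -tpi1 tE. Qed.
Lemma tsgZ c : {morph tsg : x / c *: x}.
Proof. by elim/talg_ind=> s; rewrite -tpiZ !tE -tpiZ. Qed.
Lemma tsgK : involutive tsg.
Proof.
elim/talg_ind; elim=> [g|c|s hs t ht|s hs t ht].
- by rewrite !tE /= !tpiZ scalerA -expr2 sqrr_sign scale1r.
- by rewrite !tE.
- by rewrite tpiD !tsgD hs ht.
- by rewrite tpiM !tsgM hs ht.
Qed.

HB.instance Definition _ := isSuperRing.Build talg tsgD tsgM tsg1 tsgK.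
HB.instance Definition _ := isSuperLinear.Build C talg tsgZ.

Definition tgen (g : G) : talg := tpi (Gen g).

End Terms.

(* The superalgebra with generators G (of parity par) and relations R.        *)
Section Presented.
Variables (C : numClosedFieldType) (G : Type) (par : G -> bool).
Variable R : term C G -> term C G -> Prop.

Inductive gcong : term C G -> term C G -> Prop :=
  | gc_rel s t : R s t -> gcong s t
  | gc_refl s : gcong s s
  | gc_sym s t : gcong s t -> gcong t s
  | gc_trans s t u : gcong s t -> gcong t u -> gcong s u
  | gc_Add s s' t t' : gcong s s' -> gcong t t' -> gcong (Add s t) (Add s' t')
  | gc_Mul s s' t t' : gcong s s' -> gcong t t' -> gcong (Mul s t) (Mul s' t')
  | gc_addA s t u : gcong (Add s (Add t u)) (Add (Add s t) u)
  | gc_addC s t : gcong (Add s t) (Add t s)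
  | gc_add0 s : gcong (Add (Cst G 0) s) s
  | gc_mulA s t u : gcong (Mul s (Mul t u)) (Mul (Mul s t) u)
  | gc_mul1 s : gcong (Mul (Cst G 1) s) s
  | gc_mul0 s : gcong (Mul (Cst G 0) s) (Cst G 0)
  | gc_mulDl s t u : gcong (Mul (Add s t) u) (Add (Mul s u) (Mul t u))
  | gc_mulDr s t u : gcong (Mul u (Add s t)) (Add (Mul u s) (Mul u t))
  | gc_cstD c d : gcong (Cst G (c + d)) (Add (Cst G c) (Cst G d))
  | gc_cstM c d : gcong (Cst G (c * d)) (Mul (Cst G c) (Cst G d))
  | gc_central c s : gcong (Mul (Cst G c) s) (Mul s (Cst G c)).

Section Eval.
Variables (B : algType C) (f : G -> B).

Fixpoint teval (t : term C G) : B :=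
  match t with
  | Gen g => f g
  | Cst c => c%:A
  | Add s t => teval s + teval t
  | Mul s t => teval s * teval t
  end.

Lemma gcong_teval (HR : forall s t, R s t -> teval s = teval t) s t :
  gcong s t -> teval s = teval t.
Proof.
elim=> //=.
- by move=> ? ? ? _ -> _ ->.
- by move=> ? ? ? ? _ -> _ ->.
- by move=> ? ? ? ? _ -> _ ->.
- by move=> ? ? ?; rewrite addrA.
- by move=> ? ?; rewrite addrC.
- by move=> ?; rewrite scale0r add0r.
- by move=> ? ? ?; rewrite mulrA.
- by move=> ?; rewrite scale1r mul1r.
- by move=> ?; rewrite scale0r mul0r.
- by move=> ? ? ?; rewrite mulrDl.
- by move=> ? ? ?; rewrite mulrDr.
- by move=> ? ?; rewrite scalerDl.
- by move=> ? ?; rewrite mulr_algl scalerA.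
- by move=> ? ?; rewrite mulr_algl mulr_algr.
Qed.

End Eval.

Hypothesis R_tsgn : forall s t, R s t -> gcong (tsgn par s) (tsgn par t).
Hypothesis R_aug : forall s t, R s t ->
  teval (B := C^o) (fun=> 0) s = teval (B := C^o) (fun=> 0) t.

Lemma gcong_alg : alg_cong par gcong.
Proof.
split; try by constructor.
- exact: gc_trans.
- by move=> s t; elim=> //=; by [constructor | move=> *; apply: gc_sym
    | move=> ? ? ? _ h1 _ h2; apply: gc_trans h1 h2].
- move=> /(gcong_teval R_aug) /=; rewrite scale1r scale0r => /eqP.
  by rewrite oner_eq0.
Qed.

Lemma presented_lift (B : algType C) (f : G -> B) :
  (forall s t, R s t -> teval f s = teval f t) ->
  exists phi : {lrmorphism talg gcong_alg -> B},
    forall g, phi (tgen gcong_alg g) = f g.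
Proof.
move=> HR; pose h (x : talg gcong_alg) : B := teval f (trepr x).
have hE s : h (tpi gcong_alg s) = teval f s.
  by apply: (gcong_teval HR); apply: trepr_pi.
have hD : {morph h : x y / x + y}.
  elim/talg_ind=> s; elim/talg_ind=> t.
  by rewrite -tpiD !hE.
have hM : {morph h : x y / x * y}.
  by elim/talg_ind=> s; elim/talg_ind=> t; rewrite -tpiM !hE.
have h1 : h 1 = 1 by rewrite -tpi1 hE /= scale1r.
have hZ : scalable h.
  by move=> c; elim/talg_ind=> s; rewrite -tpiZ !hE /= mulr_algl.
have h0 : h 0 = 0 by apply: (addrI (h 0)); rewrite -hD !addr0.
pose m1 := GRing.isNmodMorphism.Build _ _ h (h0, hD).
pose m2 := GRing.isMonoidMorphism.Build _ _ h (h1, hM).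
pose m3 := GRing.isScalable.Build _ _ _ _ h hZ.
pose H : {lrmorphism talg gcong_alg -> B} := HB.pack h m1 m2 m3.
by exists H => g; exact: (hE (Gen C g)).
Qed.

End Presented.

(* [(false, k)] is the positive index k and [(true, k)] the negative index -k *)
(* (k is counted from 0); the first component is the parity.                  *)
Definition sidx (n : nat) : Type := (bool * 'I_n)%type.
HB.instance Definition _ n := Finite.on (sidx n).
Definition pos n (k : 'I_n) : sidx n := (false, k).
Definition neg n (k : 'I_n) : sidx n := (true, k).
Definition sopp n (i : sidx n) : sidx n := (~~ i.1, i.2).

Section Queer.
Variables (C : numClosedFieldType) (N : nat).

Definition sord (i : sidx N) : 'I_(N + N) :=
  if i.1 then rshift N i.2 else lshift N i.2.

Definition Emx (i j : sidx N) : 'M[C]_(N + N) := delta_mx (sord i) (sord j).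
Definition Fmx (i j : sidx N) := Emx i j + Emx (sopp i) (sopp j).

(* The component of parity p of the Lie superalgebra q_N inside gl_{N|N}. *)
Definition qN (p : bool) : {vspace 'M[C]_(N + N)} :=
  <<[seq Fmx ij.1 ij.2 |
     ij <- enum [pred ij : sidx N * sidx N | ij.1.1 (+) ij.2.1 == p]]>>%VS.

Lemma Fmx_qN (i j : sidx N) : Fmx i j \in qN (i.1 (+) j.1).
Proof.
apply: memv_span; apply/mapP; exists (i, j) => //.
by rewrite mem_enum inE.
Qed.

(* U(q_N) is generated by the homogeneous elements (p, A) of q_N, subject to  *)
(* linearity in A and [A, B] = A B - (-1)^{pq} B A; the bracket of q_N is the *)
(* supercommutator of matrices.                                               *)
Definition qgen : Type := {p : bool & subvs_of (qN p)}.
Definition qpar (g : qgen) : bool := projT1 g.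
Definition qGen p (A : subvs_of (qN p)) : term C qgen :=
  Gen C (existT (fun p => subvs_of (qN p)) p A).

Inductive qrel : term C qgen -> term C qgen -> Prop :=
  | qrel_linear p (c : C) (A B : subvs_of (qN p)) :
      qrel (qGen (c *: A + B)) (Add (Mul (Cst _ c) (qGen A)) (qGen B))
  | qrel_bracket p q (A : subvs_of (qN p)) (B : subvs_of (qN q))
      (D : subvs_of (qN (p (+) q))) :
      vsval D = vsval A *m vsval B - (-1) ^+ (p && q) *: (vsval B *m vsval A) ->
      qrel (Add (Mul (qGen A) (qGen B))
                (Mul (Cst _ (- (-1) ^+ (p && q))) (Mul (qGen B) (qGen A))))
           (qGen D).

Local Notation "s ~~~ t" := (gcong qrel s t) (at level 70).

Lemma gc_Mulr (s t t' : term C qgen) : t ~~~ t' -> Mul s t ~~~ Mul s t'.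
Proof. by move=> h; apply: gc_Mul => //; apply: gc_refl. Qed.
Lemma gc_Mull (s t t' : term C qgen) : t ~~~ t' -> Mul t s ~~~ Mul t' s.
Proof. by move=> h; apply: gc_Mul => //; apply: gc_refl. Qed.

Lemma gc_swap c (s t : term C qgen) :
  Mul s (Mul (Cst _ c) t) ~~~ Mul (Cst _ c) (Mul s t).
Proof.
apply: gc_trans (gc_mulA _ _ _ _) _.
apply: gc_trans (gc_Mull _ (gc_sym (gc_central _ _ _))) _.
exact: gc_sym (gc_mulA _ _ _ _).
Qed.

Lemma gc_scal c d (s t : term C qgen) :
  Mul (Mul (Cst _ c) s) (Mul (Cst _ d) t) ~~~ Mul (Cst _ (c * d)) (Mul s t).
Proof.
apply: gc_trans (gc_sym (gc_mulA _ _ _ _)) _.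
apply: gc_trans (gc_Mulr _ (gc_swap _ _ _)) _.
apply: gc_trans (gc_mulA _ _ _ _) _.
exact: gc_Mull (gc_sym (gc_cstM _ _ _)).
Qed.

Lemma qrel_tsgn s t : qrel s t -> tsgn qpar s ~~~ tsgn qpar t.
Proof.
case=> [p c A B|p q A B D hD] /=; rewrite /qpar /=.
  apply: gc_trans (gc_Mulr _ (gc_rel (qrel_linear _ _ _))) _.
  apply: gc_trans (gc_mulDr _ _ _ _) _.
  apply: gc_Add (gc_refl _ _).
  exact: gc_swap.
apply: gc_sym.
apply: gc_trans (gc_Mulr _ (gc_sym (gc_rel (qrel_bracket hD)))) _.
rewrite signr_addb.
apply: gc_trans (gc_mulDr _ _ _ _) _.
apply: gc_Add; first exact: gc_sym (gc_scal _ _ _ _).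
apply: gc_trans (gc_swap _ _ _) _.
apply: gc_Mulr; rewrite mulrC.
exact: gc_sym (gc_scal _ _ _ _).
Qed.

Lemma qrel_aug s t : qrel s t ->
  teval (B := C^o) (fun=> 0) s = teval (B := C^o) (fun=> 0) t.
Proof. by case=> [p c A B|p q A B D hD] /=; rewrite !mulr0 addr0. Qed.

Definition Uq := talg (gcong_alg qrel_tsgn qrel_aug).
HB.instance Definition _ := SuperAlgebra.on Uq.

Definition UF (i j : sidx N) : Uq :=
  tgen _ (existT (fun p => subvs_of (qN p)) (i.1 (+) j.1) (Subvs (Fmx_qN i j))).

End Queer.

Section DiffOp.
Variables (C : numClosedFieldType) (M N : nat).

(* [(a, k)] indexes the variable x_{ak}. *)
Definition xidx : Type := (sidx M * 'I_N)%type.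
HB.instance Definition _ := Finite.on xidx.
Definition xpar (u : xidx) : bool := u.1.1.

Inductive xrel : term C xidx -> term C xidx -> Prop :=
  | xrel_comm u v :
      xrel (Mul (Gen C u) (Gen C v))
           (Mul (Cst _ ((-1) ^+ (xpar u && xpar v))) (Mul (Gen C v) (Gen C u))).

Lemma gc_xswap c (s t : term C xidx) :
  gcong xrel (Mul s (Mul (Cst _ c) t)) (Mul (Cst _ c) (Mul s t)).
Proof.
apply: gc_trans (gc_mulA _ _ _ _) _.
apply: gc_trans (gc_Mul (gc_sym (gc_central _ _ _)) (gc_refl _ _)) _.
exact: gc_sym (gc_mulA _ _ _ _).
Qed.

Lemma gc_xscal c d (s t : term C xidx) :
  gcong xrel (Mul (Mul (Cst _ c) s) (Mul (Cst _ d) t))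
             (Mul (Cst _ (c * d)) (Mul s t)).
Proof.
apply: gc_trans (gc_sym (gc_mulA _ _ _ _)) _.
apply: gc_trans (gc_Mul (gc_refl _ _) (gc_xswap _ _ _)) _.
apply: gc_trans (gc_mulA _ _ _ _) _.
exact: gc_Mul (gc_sym (gc_cstM _ _ _)) (gc_refl _ _).
Qed.

Lemma xrel_tsgn s t : xrel s t -> gcong xrel (tsgn xpar s) (tsgn xpar t).
Proof.
case=> u v /=.
apply: gc_trans (gc_xscal _ _ _ _) _.
apply: gc_trans (gc_Mul (gc_refl _ _) (gc_rel (xrel_comm _ _))) _.
apply: gc_trans (gc_xswap _ _ _) _; apply: gc_Mul (gc_refl _ _) _.
by rewrite mulrC; apply: gc_sym (gc_xscal _ _ _ _).
Qed.

Lemma xrel_aug s t : xrel s t ->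
  teval (B := C^o) (fun=> 0) s = teval (B := C^o) (fun=> 0) t.
Proof. by case=> u v /=; rewrite !mulr0. Qed.

Definition xcong := gcong_alg xrel_tsgn xrel_aug.
Definition Pol := talg xcong.
HB.instance Definition _ := SuperAlgebra.on Pol.

Definition polx (u : xidx) : Pol := tgen xcong u.

Lemma polxC u v :
  polx u * polx v = (-1) ^+ (xpar u && xpar v) *: (polx v * polx u).
Proof.
rewrite /polx /tgen -!tpiM -tpiZ; apply/tpiP; apply: gc_rel; exact: xrel_comm.
Qed.

Lemma sgn_tpi s : sgn (tpi xcong s : Pol) = tpi xcong (tsgn xpar s).
Proof. exact: tsgE. Qed.

Lemma sgn_polx u : sgn (polx u) = (-1) ^+ xpar u *: polx u.
Proof. by rewrite /polx /tgen sgn_tpi /= tpiZ. Qed.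

Fixpoint tdiff (u : xidx) (t : term C xidx) : term C xidx :=
  match t with
  | Gen v => Cst _ (u == v)%:R
  | Cst _ => Cst _ 0
  | Add s t => Add (tdiff u s) (tdiff u t)
  | Mul s t => Add (Mul (tdiff u s) t)
                   (Mul (if xpar u then tsgn xpar s else s) (tdiff u t))
  end.

Let tpiE := (tpiD, tpiM, tpiC).

Lemma tpi_tdiffM u s t : tpi xcong (tdiff u (Mul s t)) =
  tpi xcong (tdiff u s) * tpi xcong t +
  sgnb (xpar u) (tpi xcong s : Pol) * tpi xcong (tdiff u t).
Proof. by rewrite /= !tpiE /sgnb; case: ifP => // _; rewrite -sgn_tpi. Qed.

Lemma sgnbM p : {morph @sgnb Pol p : x y / x * y}.
Proof. by case: p => x y //=; rewrite /sgnb sgnM. Qed.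
Lemma sgnbD p : {morph @sgnb Pol p : x y / x + y}.
Proof. by case: p => x y //=; rewrite /sgnb sgnD. Qed.
Lemma sgnb_alg p c : @sgnb Pol p c%:A = c%:A.
Proof. by case: p => //=; rewrite sgnZ sgn1. Qed.

Lemma tdiff_cong u s t : gcong xrel s t ->
  tpi xcong (tdiff u s) = tpi xcong (tdiff u t).
Proof.
have E s' t' : gcong xrel s' t' -> tpi xcong s' = tpi xcong t'.
  by move=> h; apply/tpiP.
have C0 c x : c%:A * x = x * c%:A :> Pol by rewrite mulr_algl mulr_algr.
elim=> {s t}.
- move=> s t [v w]; rewrite !tpi_tdiffM /= !tpiE scale0r mul0r add0r sgnb_alg.
  have pE z : tpi xcong (Gen C z) = polx z by [].
  rewrite !pE.
  have sE z : sgnb (xpar u) (polx z) = (-1) ^+ (xpar u && xpar z) *: polx z.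
    by rewrite /sgnb; case: (xpar u) => /=; rewrite ?sgn_polx ?scale1r.
  have H (z z' : xidx) : sgnb (xpar u) (polx z') * (u == z)%:R%:A =
      (-1) ^+ (xpar z && xpar z') *: ((u == z)%:R *: polx z') :> Pol.
    rewrite mulr_algr sE; have [->|_] := eqVneq u z; first by rewrite !scale1r.
    by rewrite !scale0r scaler0.
  rewrite !H !mulr_algl scalerDr !scalerA addrC; congr (_ *: _ + _ *: _).
    by rewrite andbC.
  by rewrite ?mulrA -signr_addb addbb mul1r.
- by [].
- by move=> s t _ ->.
- by move=> s t v _ -> _ ->.
- by move=> s s' t t' _ h1 _ h2 /=; rewrite !tpiD h1 h2.
- move=> s s' t t' /E e1 h1 /E e2 h2.
  by rewrite !tpi_tdiffM e1 e2 h1 h2.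
- by move=> s t v /=; rewrite !tpiD addrA.
- by move=> s t /=; rewrite !tpiD addrC.
- by move=> s /=; rewrite tpiD tpiC scale0r add0r.
- move=> s t v; rewrite !tpi_tdiffM !tpiM sgnbM.
  by rewrite mulrDl mulrDr !mulrA addrA.
- move=> s; rewrite tpi_tdiffM /= !tpiC scale0r mul0r add0r sgnb_alg.
  by rewrite scale1r mul1r.
- by move=> s; rewrite tpi_tdiffM /= !tpiC sgnb_alg scale0r !mul0r addr0.
- move=> s t v; rewrite [tdiff u (Add (Mul s v) _)]/= tpiD !tpi_tdiffM.
  by rewrite [tdiff u (Add s t)]/= !tpiD sgnbD !mulrDl addrACA.
- move=> s t v; rewrite [tdiff u (Add (Mul v s) _)]/= tpiD !tpi_tdiffM.
  by rewrite [tdiff u (Add s t)]/= !tpiD !mulrDr addrACA.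
- by move=> c d /=; rewrite tpiD !tpiC scale0r addr0.
- move=> c d; rewrite tpi_tdiffM /= !tpiC scale0r mul0r mulr0.
  by rewrite addr0.
- move=> c s; rewrite !tpi_tdiffM /= !tpiC scale0r mul0r mulr0 add0r addr0.
  by rewrite sgnb_alg C0.
Qed.

(* The left derivation of P of parity xpar u with x_v |-> delta_{uv}. *)
Definition pder (u : xidx) (f : Pol) : Pol := tpi xcong (tdiff u (trepr f)).

Lemma pder_tpi u s : pder u (tpi xcong s) = tpi xcong (tdiff u s).
Proof. by apply: tdiff_cong; apply: (trepr_pi xcong). Qed.

Lemma pder_polx u v : pder u (polx v) = (u == v)%:R.
Proof. by rewrite /polx /tgen pder_tpi /= tpiC scaler_nat. Qed.

Lemma pderD u : {morph pder u : f g / f + g}.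
Proof.
by elim/talg_ind=> s; elim/talg_ind=> t; rewrite -tpiD !pder_tpi /= tpiD.
Qed.

Lemma pderM u f g :
  pder u (f * g) = pder u f * g + sgnb (xpar u) f * pder u g.
Proof.
elim/talg_ind: f => s; elim/talg_ind: g => t.
by rewrite -tpiM !pder_tpi tpi_tdiffM.
Qed.

Lemma pder1 u c : pder u c%:A = 0.
Proof. by rewrite -tpiC pder_tpi /= tpiC scale0r. Qed.

Lemma pderZ u c : {morph pder u : f / c *: f}.
Proof.
move=> f; rewrite -mulr_algl pderM pder1 mul0r add0r sgnb_alg mulr_algl.
by [].
Qed.

Lemma sgn_pder u f : sgn (pder u f) = (-1) ^+ xpar u *: pder u (sgn f).
Proof.
elim/talg_ind: f; elim=> [v|c|s hs t ht|s hs t ht].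
- rewrite -/(polx v) sgn_polx pderZ pder_polx.
  have [->|_] := eqVneq u v; last by rewrite !scaler0 sgn0.
  by rewrite sgn1 scalerA -expr2 sqrr_sign scale1r.
- by rewrite tpiC sgnZ sgn1 pder1 scaler0 sgn0.
- by rewrite tpiD !(sgnD, pderD) hs ht scalerDr.
- rewrite tpiM pderM !(sgnD, sgnM) pderM hs ht scalerDr; congr (_ + _).
    by rewrite scalerAl.
  rewrite -scalerAr; congr (_ *: (_ * _)).
  by case: (xpar u).
Qed.

(* Differential operators: terms in the x_u ([inl u]) and the d/dx_u          *)
(* ([inr u]), identified when they are the same operator on P.  Thus [PD] is  *)
(* the subalgebra of End(P) generated by these operators.                     *)
Definition dgen : Type := (xidx + xidx)%type.
Definition dpar (g : dgen) : bool :=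
  match g with inl u => xpar u | inr u => xpar u end.

Fixpoint act (t : term C dgen) (f : Pol) : Pol :=
  match t with
  | Gen (inl u) => polx u * f
  | Gen (inr u) => pder u f
  | Cst c => c *: f
  | Add s t => act s f + act t f
  | Mul s t => act s (act t f)
  end.

Definition acteq (s t : term C dgen) : Prop := act s =1 act t.

Lemma actD t : {morph act t : f g / f + g}.
Proof.
elim: t => [[u|u]|c|s hs t ht|s hs t ht] f g /=.
- by rewrite mulrDr.
- by rewrite pderD.
- by rewrite scalerDr.
- by rewrite hs ht addrACA.
- by rewrite ht hs.
Qed.

Lemma actZ t c : {morph act t : f / c *: f}.
Proof.
elim: t => [[u|u]|d|s hs t ht|s hs t ht] f /=.
- by rewrite scalerAr.
- by rewrite pderZ.
- by rewrite !scalerA mulrC.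
- by rewrite hs ht scalerDr.
- by rewrite ht hs.
Qed.

Lemma act_tsgn t f : act (tsgn dpar t) (sgn f) = sgn (act t f).
Proof.
elim: t f => [[u|u]|d|s hs t ht|s hs t ht] f /=.
- by rewrite sgnM sgn_polx scalerAl.
- by rewrite sgn_pder.
- by rewrite sgnZ.
- by rewrite hs ht sgnD.
- by rewrite ht hs.
Qed.

Lemma acteq_alg : alg_cong dpar acteq.
Proof.
split; rewrite /acteq /=.
- by [].
- by move=> s t h f; rewrite h.
- by move=> s t u h1 h2 f; rewrite h1.
- by move=> s s' t t' h1 h2 f /=; rewrite h1 h2.
- by move=> s s' t t' h1 h2 f /=; rewrite h1 h2.
- by move=> s t u f /=; rewrite addrA.
- by move=> s t f /=; rewrite addrC.
- by move=> s f /=; rewrite scale0r add0r.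
- by [].
- by move=> s f /=; rewrite scale1r.
- by move=> s f /=; rewrite !scale0r.
- by [].
- by move=> s t u f /=; rewrite actD.
- by move=> c d f /=; rewrite scalerDl.
- by move=> c d f /=; rewrite scalerA.
- by move=> c s f /=; rewrite actZ.
- by move=> s t h f; rewrite -[f]sgnK !act_tsgn h.
- by move=> /(_ 1) /= /eqP; rewrite scale1r scale0r oner_eq0.
Qed.

Definition PD := talg acteq_alg.
HB.instance Definition _ := SuperAlgebra.on PD.

Definition px (a : sidx M) (k : 'I_N) : PD := tgen acteq_alg (inl (a, k)).
Definition pd (k : 'I_N) (a : sidx M) : PD := tgen acteq_alg (inr (a, k)).

End DiffOp.

(* The matrices e_{kl} = [Qmx (false, k, l)], f_{kl} = [Qmx (true, k, l)].    *)
Definition qbasis (J : finType) : Type := (bool * J * J)%type.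
HB.instance Definition _ J := Finite.on (qbasis J).

Section QueerMatrices.
Variables (C : numClosedFieldType) (N : nat).

Definition Qmx (b : qbasis 'I_N) : 'M[C]_(N + N) :=
  Emx C (pos b.1.2) (b.1.1, b.2) + Emx C (neg b.1.2) (~~ b.1.1, b.2).

Lemma sord_inj : injective (@sord N).
Proof.
move=> [[] i] [[] j] /eqP; rewrite /sord /=.
- by rewrite eq_rshift => /eqP ->.
- by rewrite eq_rlshift.
- by rewrite eq_lrshift.
- by rewrite eq_lshift => /eqP ->.
Qed.

Lemma EmxM (i j k l : sidx N) :
  Emx C i j *m Emx C k l = if j == k then Emx C i l else 0.
Proof. by rewrite /Emx mul_delta_mx_cond (inj_eq sord_inj); case: eqP. Qed.

Lemma QmxM s k l t l' m : Qmx (s, k, l) *m Qmx (t, l', m) =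
  if l == l' then Qmx (s (+) t, k, m) else 0.
Proof.
rewrite /Qmx /= mulmxDl !mulmxDr !EmxM.
rewrite /pos /neg !xpair_eqE; case: (l == l'); rewrite ?andbF ?addr0 //.
by case: s t => [] [] /=; rewrite ?addr0 ?add0r.
Qed.

End QueerMatrices.

(* Q_J (x) A, where the superalgebra Q_J has basis e_{ij} = (false, i, j)     *)
(* (even) and f_{ij} = (true, i, j) (odd), i, j in J, multiplied as in        *)
(* [QmxM]. The value at b of an element is its coefficient in A: u stands     *)
(* for the sum of the b (x) u b. Moving an odd basis vector past a            *)
(* coefficient applies [sgn] to the latter.                                   *)
Section QTensor.
Variables (J : finType) (A : superRingType).

Definition qten : Type := {ffun qbasis J -> A}.
HB.instance Definition _ := GRing.Zmodule.on qten.

Implicit Types u v w : qten.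

Definition qmul u v : qten :=
  [ffun b : qbasis J => \sum_(t : bool) \sum_(r : J)
     sgnb (b.1.1 (+) t) (u (t, b.1.2, r)) * v (b.1.1 (+) t, r, b.2)].
Definition qone : qten := [ffun b : qbasis J => (~~ b.1.1 && (b.1.2 == b.2))%:R].
Definition qsgn u : qten := [ffun b : qbasis J => (-1) ^+ b.1.1 * sgn (u b)].

Lemma sgnb_sum h I (r : seq I) (F : I -> A) :
  sgnb h (\sum_(i <- r) F i) = \sum_(i <- r) sgnb h (F i).
Proof. by case: h; rewrite // /sgnb sgn_sum. Qed.
Lemma sgnbM' h (x y : A) : sgnb h (x * y) = sgnb h x * sgnb h y.
Proof. by case: h; rewrite // /sgnb sgnM. Qed.
Lemma sgnbb h h' (x : A) : sgnb h (sgnb h' x) = sgnb (h (+) h') x.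
Proof. by case: h h' => [] []; rewrite // /sgnb sgnK. Qed.

Lemma sgnb0 h : sgnb h (0 : A) = 0.
Proof. by case: h; rewrite // /sgnb sgn0. Qed.
Lemma sgnb1 h : sgnb h (1 : A) = 1.
Proof. by case: h; rewrite // /sgnb sgn1. Qed.

Lemma qmulA : associative qmul.
Proof.
move=> u v w; apply/ffunP => [[[s p] q]].
transitivity (\sum_(t : bool) \sum_(r : J) \sum_(x : bool) \sum_(r' : J)
   sgnb (s (+) t) (u (t, p, r)) * (sgnb (s (+) x) (v (t (+) x, r, r')) *
   w (s (+) x, r', q))); rewrite ffunE /=.
  apply: eq_bigr => t _; apply: eq_bigr => r _; rewrite ffunE /=.
  rewrite (reindex_inj (@addbI t)) /= mulr_sumr; apply: eq_bigr => x _.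
  rewrite mulr_sumr; apply: eq_bigr => r' _.
  by rewrite addbA -[(s (+) t) (+) t]addbA addbb addbF.
transitivity (\sum_(x : bool) \sum_(r' : J) \sum_(t : bool) \sum_(r : J)
   sgnb (s (+) t) (u (t, p, r)) * (sgnb (s (+) x) (v (t (+) x, r, r')) *
   w (s (+) x, r', q))); last first.
  apply: eq_bigr => x _; apply: eq_bigr => r' _; rewrite ffunE /=.
  rewrite sgnb_sum mulr_suml; apply: eq_bigr => t _.
  rewrite sgnb_sum mulr_suml; apply: eq_bigr => r _.
  rewrite sgnbM' sgnbb mulrA addbA -[(s (+) x) (+) x]addbA addbb addbF.
  by rewrite [x (+) t]addbC.
pose F t r x r' := sgnb (s (+) t) (u (t, p, r)) *
  (sgnb (s (+) x) (v (t (+) x, r, r')) * w (s (+) x, r', q)).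
rewrite -/F; rewrite (pair_bigA _ (fun t r => \sum_x \sum_r' F t r x r')) /=.
rewrite (pair_bigA _ (fun x r' => \sum_t \sum_r F t r x r')) /=.
under eq_bigr => i _ do rewrite (pair_bigA _ (fun x r' => F i.1 i.2 x r')) /=.
under [RHS]eq_bigr => i _ do
  rewrite (pair_bigA _ (fun t r => F t r i.1 i.2)) /=.
exact: exchange_big.
Qed.

Lemma qmul1 : left_id qone qmul.
Proof.
move=> u; apply/ffunP => [[[s p] q]]; rewrite ffunE big_bool /=.
rewrite [X in X + _]big1 ?add0r => [|r _]; last first.
  by rewrite ffunE /= sgnb0 mul0r.
rewrite (bigD1 p) //= big1 ?addr0 => [|r].
  by rewrite ffunE /= eqxx sgnb1 mul1r addbF.
by rewrite eq_sym ffunE /= => /negbTE ->; rewrite sgnb0 mul0r.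
Qed.

Lemma qmulr1 : right_id qone qmul.
Proof.
move=> u; apply/ffunP => [[[s p] q]]; rewrite ffunE (bigD1 s) //=.
rewrite [X in _ + X]big1 ?addr0 => [|t]; last first.
  by case: s t => [] [] //= _; rewrite big1 // => r _; rewrite ffunE mulr0.
rewrite addbb (bigD1 q) //= big1 ?addr0 => [|r].
  by rewrite ffunE /= eqxx mulr1.
by rewrite ffunE /= => /negbTE ->; rewrite mulr0.
Qed.

Lemma qmulDl : left_distributive qmul +%R.
Proof.
move=> u v w; apply/ffunP => b; rewrite !ffunE -big_split; apply: eq_bigr => t _.
rewrite -big_split; apply: eq_bigr => r _; rewrite ffunE /= /sgnb.
by case: ifP; rewrite ?sgnD mulrDl.
Qed.

Lemma qmulDr : right_distributive qmul +%R.
Proof.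
move=> u v w; apply/ffunP => b; rewrite !ffunE -big_split; apply: eq_bigr => t _.
by rewrite -big_split; apply: eq_bigr => r _; rewrite ffunE mulrDr.
Qed.

HB.instance Definition _ := GRing.Zmodule_isPzRing.Build qten
  qmulA qmul1 qmulr1 qmulDl qmulDr.

Lemma sgn_sign (h : bool) (x : A) : sgn ((-1) ^+ h * x) = (-1) ^+ h * sgn x.
Proof. by case: h; rewrite ?mul1r ?mulN1r ?sgnN. Qed.

Lemma qsgnD : {morph qsgn : u v / u + v}.
Proof. by move=> u v; apply/ffunP => b; rewrite !ffunE sgnD mulrDr. Qed.
Lemma qsgnM : {morph qsgn : u v / u * v}.
Proof.
move=> u v; apply/ffunP => [[[s p] q]]; rewrite !ffunE sgn_sum mulr_sumr /=.
apply: eq_bigr => t _; rewrite sgn_sum mulr_sumr; apply: eq_bigr => r _.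
rewrite !ffunE /= sgnM.
have -> : sgnb (s (+) t) ((-1) ^+ t * sgn (u (t, p, r))) =
    (-1) ^+ t * sgn (sgnb (s (+) t) (u (t, p, r))).
  by rewrite /sgnb; case: ifP => // _; rewrite sgn_sign.
rewrite -mulrA !mulr_sign; case: s t => [] [] //=;
  by rewrite ?mulrN ?mulNr ?opprK.
Qed.
Lemma qsgn1 : qsgn 1 = 1.
Proof.
apply/ffunP => [[[s p] q]]; rewrite !ffunE /=.
by case: s => /=; case: (p == q); rewrite /= ?sgn0 ?sgn1 ?mulr0 ?mul1r.
Qed.
Lemma qsgnK : involutive qsgn.
Proof.
move=> u; apply/ffunP => b; rewrite !ffunE sgn_sign sgnK mulrA -expr2.
by rewrite sqrr_sign mul1r.
Qed.

HB.instance Definition _ := isSuperRing.Build qten qsgnD qsgnM qsgn1 qsgnK.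

(* The pure tensor b (x) a. *)
Definition qpure (b : qbasis J) (a : A) : qten :=
  [ffun b' => if b' == b then a else 0].

Lemma qpureM s p r t r' q (a c : A) : qpure (s, p, r) a * qpure (t, r', q) c =
  if r == r' then qpure (s (+) t, p, q) (sgnb t a * c) else 0.
Proof.
apply/ffunP => [[[x i] j]]; rewrite ffunE /= (bigD1 s) //=.
rewrite [X in _ + X]big1 ?addr0 => [|y /negbTE ys]; last first.
  by rewrite big1 // => k _; rewrite !ffunE !xpair_eqE ys sgnb0 mul0r.
rewrite (bigD1 r) //= big1 ?addr0 => [|k /negbTE kr]; last first.
  by rewrite !ffunE !xpair_eqE kr !andbF sgnb0 mul0r.
rewrite !ffunE !xpair_eqE !eqxx andbT /=.
have -> : (x (+) s == t) = (x == s (+) t) by case: x s t => [] [] [].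
have [_ | _] := eqVneq r r'; last by rewrite andbF mulr0 ffunE.
rewrite ffunE !xpair_eqE andbT; have [->|_] /= := eqVneq x (s (+) t); last by rewrite mulr0.
rewrite addbAC addbb /=.
by case: (i == p); case: (j == q); rewrite ?sgnb0 ?mul0r ?mulr0.
Qed.

End QTensor.

(* The iterated tensor product Q_J (x) (Q_J (x) ... (Q_J (x) A)). *)
Fixpoint tpow (J : finType) (A : superRingType) (n : nat) : superRingType :=
  if n is n'.+1 then qten J (tpow J A n') else A.

Section TensorPower.
Variables (J : finType) (A : superRingType).

(* q_1 (x) ... (x) q_n (x) a, where q_r is the basis vector b if              *)
(* [w r = Some b], and q_r = 1 if [w r = None].                               *)
Fixpoint ptens n : ('I_n -> option (qbasis J)) -> A -> tpow J A n :=
  match n return ('I_n -> option (qbasis J)) -> A -> tpow J A n with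
  | 0 => fun _ a => a
  | n'.+1 => fun w a =>
      [ffun b => if (if w ord0 is Some b0 then b == b0
                     else ~~ b.1.1 && (b.1.2 == b.2))
                 then ptens (fun r => w (lift ord0 r)) a else 0]
  end.

Definition tens1 n (r : 'I_n) (b : qbasis J) (a : A) : tpow J A n :=
  ptens (fun s => if s == r then Some b else None) a.

Definition tens2 n (r : 'I_n) (b : qbasis J) (r' : 'I_n) (b' : qbasis J) (a : A) :
    tpow J A n :=
  ptens (fun s => if s == r then Some b else
                  if s == r' then Some b' else None) a.

End TensorPower.

(* id (x) phi, phi being applied in the last tensor factor. *)
Fixpoint tmap (J : finType) (A B : superRingType) (phi : A -> B) n :
    tpow J A n -> tpow J B n :=
  match n return tpow J A n -> tpow J B n with
  | 0 => phi
  | n'.+1 => fun u => [ffun b => @tmap J A B phi n' (u b)]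
  end.

(* The inclusion induced in each tensor factor by Q_J -> Q_{J + K}. *)
Fixpoint temb (J K : finType) (A : superRingType) n :
    tpow J A n -> tpow (J + K)%type A n :=
  match n return tpow J A n -> tpow (J + K)%type A n with
  | 0 => id
  | n'.+1 => fun u =>
      [ffun b : qbasis (J + K)%type =>
         match b.1.2, b.2 return tpow (J + K)%type A n' with
         | inl i, inl j => @temb J K A n' (u (b.1.1, i, j))
         | _, _ => 0
         end]
  end.

Lemma temb_inj (J K : finType) (A : superRingType) n : injective (@temb J K A n).
Proof.
elim: n => [|n IH] //= u v /ffunP h; apply/ffunP => -[[s i] j].
by have := h (s, inl i, inl j); rewrite !ffunE /= => /IH.
Qed.

Definition eb (J : finType) (k l : J) : qbasis J := (false, k, l).
Definition fb (J : finType) (k l : J) : qbasis J := (true, k, l).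

Section Elements.
Variables (C : numClosedFieldType) (M N n : nat).

Definition Gop (a : 'I_n) : tpow 'I_N (Uq C N) n :=
  \sum_(k < N) \sum_(l < N)
    (tens1 a (eb k l) (UF C (pos l) (neg k)) -
     tens1 a (fb k l) (UF C (pos l) (pos k))).

Definition Tab (a b : 'I_n) : tpow 'I_N (Uq C N) n :=
  \sum_(k < N) \sum_(l < N)
    (tens2 a (fb k l) b (eb l k) 1 - tens2 a (eb k l) b (fb l k) 1).

Definition JM (b : 'I_n) : tpow 'I_N (Uq C N) n :=
  \sum_(a < n | (a < b)%N) Tab a b.

(* The spaces Hom(C^M, C^{N|N}), Hom(C^{N|N}, C^M) and Q_N, together with     *)
(* their products, are blocks of Q_J for J = 'I_N + 'I_M: the index inl k     *)
(* stands for k in 1..N, the index inr a for a in 1..M.                       *)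
Let J : finType := ('I_N + 'I_M)%type.

Definition Xop (r : 'I_n) : tpow J (PD C M N) n :=
  \sum_(a < M) \sum_(k < N)
    (tens1 r (eb (inl k : J) (inr a)) (px C (pos a) k) -
     tens1 r (fb (inl k : J) (inr a)) ('i *: px C (neg a) k)).

Definition Dop (r : 'I_n) : tpow J (PD C M N) n :=
  \sum_(a < M) \sum_(k < N)
    (tens1 r (eb (inr a : J) (inl k)) ('i *: pd C k (neg a)) +
     tens1 r (fb (inr a : J) (inl k)) (pd C k (pos a))).

End Elements.

Section WeylRelations.
Variables (C : numClosedFieldType) (M N : nat).
Implicit Types u v s t : xidx M N.

Lemma pderC u v (f : Pol C M N) :
  pder u (pder v f) = (-1) ^+ (xpar u && xpar v) *: pder v (pder u f).
Proof.
have sC w w' (g : Pol C M N) : sgnb (xpar w) (pder w' g) =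
    (-1) ^+ (xpar w && xpar w') *: pder w' (sgnb (xpar w) g).
  by rewrite /sgnb; case: (xpar w) => /=; rewrite ?sgn_pder ?scale1r.
elim/talg_ind: f; elim=> [w|c|f hf g hg|f hf g hg].
- by rewrite -/(polx _ w) !pder_polx -!scaler_nat !pder1 scaler0.
- by rewrite tpiC !pder1 -[0](scale0r 1) !pder1 scaler0.
- by rewrite tpiD !pderD hf hg scalerDr.
- rewrite tpiM !(pderM, pderD) hf hg !sC !(scalerDr, pderZ).
  rewrite -!scalerAl -!scalerAr !scalerA -!addrA; congr (_ + _).
  rewrite addrCA; congr (_ + (_ + _)).
  + by rewrite [xpar v && _]andbC -signr_addb addbb scale1r.
  + by rewrite !sgnbb [xpar v (+) _]addbC.
Qed.

Definition Dx u : PD C M N := tgen (acteq_alg C M N) (inl u).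
Definition Dd u : PD C M N := tgen (acteq_alg C M N) (inr u).

Lemma DxDx u v : Dx u * Dx v = (-1) ^+ (xpar u && xpar v) *: (Dx v * Dx u).
Proof.
rewrite /Dx /tgen -!tpiM -tpiZ; apply/tpiP => f /=.
by rewrite mulrA polxC -scalerAl mulrA.
Qed.

Lemma DdDd u v : Dd u * Dd v = (-1) ^+ (xpar u && xpar v) *: (Dd v * Dd u).
Proof. by rewrite /Dd /tgen -!tpiM -tpiZ; apply/tpiP => f /=; apply: pderC. Qed.

Lemma DdDx u v : Dd u * Dx v =
  (u == v)%:R%:A + (-1) ^+ (xpar u && xpar v) *: (Dx v * Dd u).
Proof.
have -> : (u == v)%:R%:A = tpi (acteq_alg C M N) (Cst _ (u == v)%:R) :> PD C M N.
  by rewrite tpiC.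
rewrite /Dd /Dx /tgen -!tpiM -tpiZ -tpiD.
apply/tpiP => f /=; rewrite pderM pder_polx scaler_nat mulr_natl.
congr (_ + _).
by rewrite /sgnb; case: (xpar u); rewrite /= ?sgn_polx ?scale1r ?scalerAl.
Qed.

Lemma DxDdC u v s t (e := (-1) ^+ ((xpar u (+) xpar v) && (xpar s (+) xpar t)) : C) :
  Dx u * Dd v * (Dx s * Dd t) - e *: (Dx s * Dd t * (Dx u * Dd v)) =
  (v == s)%:R *: (Dx u * Dd t) - (e * (t == u)%:R) *: (Dx s * Dd v).
Proof.
have H x y z w : Dx x * Dd y * (Dx z * Dd w) = (y == z)%:R *: (Dx x * Dd w) +
    (-1) ^+ (xpar y && xpar z) *: (Dx x * Dx z * (Dd y * Dd w)).
  rewrite -mulrA [Dd y * _]mulrA DdDx mulrDl mulrDr mulr_algl.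
  by rewrite -scalerAl -!scalerAr !mulrA.
rewrite !H (DxDx u s) (DdDd v t) -!scalerAl -!scalerAr !scalerA scalerDr !scalerA.
rewrite opprD addrACA [X in _ + X](_ : _ = 0) ?addr0 //.
rewrite -scalerBl [X in X *: _](_ : _ = 0) ?scale0r // /e.
rewrite -!signr_addb; apply/eqP; rewrite subr_eq0; apply/eqP; congr (_ ^+ nat_of_bool _).
by case: (xpar u) (xpar v) (xpar s) (xpar t) => [] [] [] [].
Qed.

End WeylRelations.

(* Existence of the homomorphism from U(q_N) to PD with the values required   *)
(* in the theorem; it sends (p, A) to the operator [qN_oscillator].           *)
Section Oscillator.
Variables (C : numClosedFieldType) (M N : nat).

Lemma qN_entries p (A : 'M[C]_(N + N)) : A \in qN C N p ->
  forall i j : sidx N,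
    (i.1 (+) j.1 != p -> A (sord i) (sord j) = 0) /\
    A (sord (sopp i)) (sord (sopp j)) = A (sord i) (sord j).
Proof.
have soppK (i j : sidx N) : (sopp i == j) = (i == sopp j).
  by case: i j => [[] i] [[] j].
move=> hA; rewrite (coord_span hA) => i j; rewrite !summxE.
set T := map_tuple _ _.
have hT (k : 'I_#|[pred ij : sidx N * sidx N | ij.1.1 (+) ij.2.1 == p]|) :
    exists2 ij : sidx N * sidx N, ij.1.1 (+) ij.2.1 == p & T`_k = Fmx C ij.1 ij.2.
  have : T`_k \in tval T by apply: mem_nth; rewrite size_tuple.
  by case/mapP => ij; rewrite mem_enum inE => h ->; exists ij.
split.
  move=> hij; apply: big1 => k _; rewrite mxE.
  have [[i' j'] /= /eqP hp ->] := hT k.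
  rewrite !mxE !(inj_eq (@sord_inj N)) /=.
  have -> : (i == i') && (j == j') = false.
    by apply/negP => /andP [/eqP ei /eqP ej]; move: hij; rewrite ei ej hp eqxx.
  have -> : (i == sopp i') && (j == sopp j') = false.
    apply/negP => /andP [/eqP ei /eqP ej]; move: hij.
    by rewrite ei ej /= addbN addNb negbK hp eqxx.
  by rewrite addr0 mulr0.
apply: eq_bigr => k _; rewrite !mxE; congr (_ * _).
have [[i' j'] _ ->] := hT k.
rewrite !mxE !(inj_eq (@sord_inj N)) /= addrC !soppK.
have sK (x : sidx N) : sopp (sopp x) = x by case: x => [[] x].
by rewrite !sK.
Qed.

Definition blk (p : bool) (A : 'M[C]_(N + N)) : 'M[C]_N :=
  \matrix_(k, l) A (sord (pos k)) (sord (p, l)).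

Lemma blkM p q A B : A \in qN C N p -> B \in qN C N q ->
  blk (p (+) q) (A *m B) = blk p A *m blk q B.
Proof.
move=> /qN_entries hA /qN_entries hB; apply/matrixP => k m; rewrite !mxE.
rewrite big_split_ord /=.
have E0 (l : 'I_N) : lshift N l = sord (pos l) by [].
have E1 (l : 'I_N) : rshift N l = sord (neg l) by [].
case: p hA => hA /=.
  rewrite big1 ?add0r => [|l _]; last first.
    by rewrite E0 (proj1 (hA _ _)) ?mul0r.
  apply: eq_bigr => l _; rewrite !mxE E1; congr (_ * _).
  by rewrite -(proj2 (hB _ _)) /sopp /= negbK.
rewrite addrC big1 ?add0r => [|l _]; last first.
  by rewrite E1 (proj1 (hA _ _)) ?mul0r.
by apply: eq_bigr => l _; rewrite !mxE E0.
Qed.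

Definition sadd (p : bool) (a : sidx M) : sidx M := (p (+) a.1, a.2).

Definition Yop (p : bool) (k l : 'I_N) : PD C M N :=
  \sum_(a : sidx M) px C a l * pd C k (sadd p a).

Lemma YopC p q k l r s (e := (-1) ^+ (p && q) : C) :
  Yop p k l * Yop q r s - e *: (Yop q r s * Yop p k l) =
  (k == s)%:R *: Yop (p (+) q) r l - (e * (l == r)%:R) *: Yop (p (+) q) k s.
Proof.
have HW a b : px C a l * pd C k (sadd p a) * (px C b s * pd C r (sadd q b)) -
    e *: (px C b s * pd C r (sadd q b) * (px C a l * pd C k (sadd p a))) =
    ((sadd p a == b) && (k == s))%:R *: (px C a l * pd C r (sadd q b)) -
    (e * ((sadd q b == a) && (r == l))%:R) *: (px C b s * pd C k (sadd p a)).
  have := @DxDdC C M N (a, l) (sadd p a, k) (b, s) (sadd q b, r).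
  rewrite /xpar /=.
  have sK (x y : bool) : x (+) (y (+) x) = y by case: x y => [] [].
  rewrite !sK.
  exact.
transitivity (\sum_a \sum_b
    (px C a l * pd C k (sadd p a) * (px C b s * pd C r (sadd q b)) -
     e *: (px C b s * pd C r (sadd q b) * (px C a l * pd C k (sadd p a))))).
  rewrite /Yop !mulr_suml; under [RHS]eq_bigr => a _ do rewrite sumrB.
  rewrite sumrB; congr (_ - _).
    by apply: eq_bigr => a _; rewrite mulr_sumr.
  rewrite scaler_sumr exchange_big /=; apply: eq_bigr => b _.
  by rewrite mulr_sumr scaler_sumr.
under eq_bigr => a _ do (under eq_bigr => b _ do rewrite HW; rewrite sumrB).
rewrite sumrB /Yop; congr (_ - _).
- rewrite scaler_sumr; apply: eq_bigr => a _.
  rewrite (bigD1 (sadd p a)) //= big1 ?addr0 => [|b hb].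
    by rewrite eqxx /= /sadd /= addbA [q (+) p]addbC.
  by rewrite eq_sym (negbTE hb) scale0r.
- rewrite exchange_big /= scaler_sumr; apply: eq_bigr => b _.
  rewrite (bigD1 (sadd q b)) //= big1 ?addr0 => [|a ha].
    by rewrite eqxx /= /sadd /= addbA eq_sym.
  by rewrite eq_sym (negbTE ha) mulr0 scale0r.
Qed.

Definition ycoef (p : bool) : C := if p then 'i else -1.

Definition qN_oscillator (g : qgen C N) : PD C M N :=
  let: existT p A := g in
  \sum_(k < N) \sum_(l < N) (blk p (vsval A) k l * ycoef p) *: Yop p k l.

Lemma qN_oscillatorE p (A : subvs_of (qN C N p)) :
  teval qN_oscillator (qGen A) =
  ycoef p *: \sum_(k < N) \sum_(l < N) blk p (vsval A) k l *: Yop p k l.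
Proof.
rewrite /= scaler_sumr; apply: eq_bigr => k _; rewrite scaler_sumr.
by apply: eq_bigr => l _; rewrite scalerA mulrC.
Qed.

Lemma blkB p (A B : 'M[C]_(N + N)) c :
  blk p (A - c *: B) = blk p A - c *: blk p B.
Proof. by apply/matrixP => k l; rewrite !mxE. Qed.

Lemma Yop_comm p q (a b : 'M[C]_N) (e := (-1) ^+ (p && q) : C)
    (S := fun p (m : 'M[C]_N) => \sum_k \sum_l m k l *: Yop p k l) :
  S p a * S q b - e *: (S q b * S p a) =
  S (p (+) q) (b *m a) - e *: S (p (+) q) (a *m b).
Proof.
have SE p' q' a' b' : S p' a' * S q' b' =
    \sum_k \sum_l \sum_r \sum_s (a' k l * b' r s) *: (Yop p' k l * Yop q' r s).
  rewrite /S mulr_suml; apply: eq_bigr => k _; rewrite mulr_suml.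
  apply: eq_bigr => l _; rewrite mulr_sumr; apply: eq_bigr => r _.
  rewrite mulr_sumr; apply: eq_bigr => s _.
  by rewrite -scalerAl -scalerAr scalerA.
transitivity (\sum_k \sum_l \sum_r \sum_s (a k l * b r s) *:
   (Yop p k l * Yop q r s - e *: (Yop q r s * Yop p k l))).
  have -> : S q b * S p a = \sum_k \sum_l \sum_r \sum_s
      (a k l * b r s) *: (Yop q r s * Yop p k l).
    rewrite SE (pair_bigA _ (fun k l => \sum_r \sum_s _ *: _)) /=.
    rewrite (pair_bigA _ (fun k l => \sum_r \sum_s _ *: _)) /=.
    under eq_bigr => i _ do rewrite pair_bigA /=.
    under [RHS]eq_bigr => i _ do rewrite pair_bigA /=.
    rewrite exchange_big; apply: eq_bigr => i _; apply: eq_bigr => i' _.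
    by rewrite mulrC.
  rewrite SE scaler_sumr -sumrB; apply: eq_bigr => k _.
  rewrite scaler_sumr -sumrB; apply: eq_bigr => l _.
  rewrite scaler_sumr -sumrB; apply: eq_bigr => r _.
  rewrite scaler_sumr -sumrB; apply: eq_bigr => s _.
  by rewrite scalerBr !scalerA [e * _]mulrC.
transitivity (\sum_k \sum_l \sum_r \sum_s
    ((a k l * b r s) * (k == s)%:R) *: Yop (p (+) q) r l -
  e *: \sum_k \sum_l \sum_r \sum_s
    ((a k l * b r s) * (l == r)%:R) *: Yop (p (+) q) k s).
  rewrite scaler_sumr -sumrB; apply: eq_bigr => k _.
  rewrite scaler_sumr -sumrB; apply: eq_bigr => l _.
  rewrite scaler_sumr -sumrB; apply: eq_bigr => r _.
  rewrite scaler_sumr -sumrB; apply: eq_bigr => s _.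
  rewrite YopC -/e scalerBr !scalerA; congr (_ - _ *: _).
  by rewrite mulrCA.
congr (_ - e *: _).
- under eq_bigr => k _ do rewrite exchange_big /=.
  rewrite exchange_big /=; apply: eq_bigr => r _.
  rewrite exchange_big /=; apply: eq_bigr => l _.
  rewrite mxE scaler_suml; apply: eq_bigr => k _.
  rewrite (bigD1 k) //= big1 ?addr0 => [|s]; first by rewrite eqxx mulr1 mulrC.
  by rewrite eq_sym => /negbTE ->; rewrite mulr0 scale0r.
- apply: eq_bigr => k _.
  under eq_bigr => l _ do rewrite exchange_big /=.
  rewrite exchange_big /=; apply: eq_bigr => s _.
  rewrite mxE scaler_suml; apply: eq_bigr => l _.
  rewrite (bigD1 l) //= big1 ?addr0 => [|r]; first by rewrite eqxx mulr1.
  by rewrite eq_sym => /negbTE ->; rewrite mulr0 scale0r.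
Qed.

Lemma scaler_comm (A : algType C) (y z e : C) (S1 S2 : A) :
  y *: S1 * (z *: S2) + - e *: (z *: S2 * (y *: S1)) =
  (y * z) *: (S1 * S2 - e *: (S2 * S1)).
Proof.
rewrite scaleNr -!scalerAl -!scalerAr scalerBr !scalerA; congr (_ - _ *: _).
by rewrite mulrC [e * z]mulrC mulrA.
Qed.

Lemma oscillator_exists : exists phi : {lrmorphism Uq C N -> PD C M N},
  (forall k l, phi (UF C (pos k) (pos l)) =
     - \sum_(a : sidx M) px C a l * pd C k a) /\
  (forall k l, phi (UF C (pos k) (neg l)) =
     'i *: \sum_(a : sidx M) px C a l * pd C k (sopp a)).
Proof.
have HR s t : qrel s t -> teval qN_oscillator s = teval qN_oscillator t.
  case=> [p c A B|p q A B D hD].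
    rewrite /= mulr_algl scaler_sumr -big_split; apply: eq_bigr => k _.
    rewrite scaler_sumr -big_split; apply: eq_bigr => l _ /=.
    by rewrite !mxE mulrDl scalerDl scalerA mulrA.
  have -> c s' t' : teval qN_oscillator (Add (Mul s' t') (Mul (Cst _ c) (Mul t' s')))
      = teval qN_oscillator s' * teval qN_oscillator t' +
        c *: (teval qN_oscillator t' * teval qN_oscillator s').
    by rewrite -[c *: _]mulr_algl.
  rewrite !qN_oscillatorE hD blkB.
  rewrite blkM ?subvsP // [in blk (p (+) q)]addbC blkM ?subvsP //.
  set a := blk p _; set b := blk q _; set e := (-1) ^+ (p && q).
  have := Yop_comm p q a b; rewrite /= -/e.
  set Sab := \sum_k \sum_l (b *m a) k l *: _; set Sba := \sum_k \sum_l (a *m b) k l *: _.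
  move=> H.
  have -> : \sum_k \sum_l (a *m b - e *: (b *m a)) k l *: Yop (p (+) q) k l =
      Sba - e *: Sab.
    rewrite /Sab /Sba scaler_sumr -sumrB; apply: eq_bigr => k _.
    rewrite scaler_sumr -sumrB; apply: eq_bigr => l _.
    have mE (m m' : 'M[C]_N) : (m - e *: m') k l = m k l - e * m' k l.
      by rewrite !mxE.
    by rewrite mE scalerBl scalerA.
  rewrite scaler_comm H.
  have ee : e * e = 1 by rewrite -signr_addb addbb.
  have -> : ycoef (p (+) q) = - (ycoef p * ycoef q * e).
    rewrite /ycoef /e; case: p q {hD A B D a b e Sab Sba H ee} => [] [] /=.
    - by rewrite -expr2 sqrCi expr1 mulrNN mulr1.
    - by rewrite expr0 mulr1 mulrN1 opprK.
    - by rewrite expr0 mulr1 mulN1r opprK.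
    - by rewrite expr0 mulr1 mulrNN mulr1.
  rewrite scaleNr -[in RHS]scalerA -scalerN; congr (_ *: _).
  by rewrite scalerBr scalerA ee scale1r opprB.
have [phi hphi] := presented_lift (@qrel_tsgn C N) (@qrel_aug C N) HR.
have bF q k l i j : blk q (Fmx C (pos k) (q, l)) i j = ((i == k) && (j == l))%:R.
  by rewrite !mxE !(inj_eq (@sord_inj N)) !xpair_eqE /= !eqxx addr0.
have YF q k l : \sum_i \sum_j
    (blk q (Fmx C (pos k) (q, l)) i j * ycoef q) *: Yop q i j =
    ycoef q *: Yop q k l.
  rewrite (bigD1 k) //= [X in _ + X]big1 ?addr0 => [|i /negbTE hi]; last first.
    by apply: big1 => j _; rewrite bF hi mul0r scale0r.
  rewrite (bigD1 l) //= big1 ?addr0 => [|j /negbTE hj].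
    by rewrite bF !eqxx mul1r.
  by rewrite bF hj andbF mul0r scale0r.
exists phi; split=> k l; rewrite hphi.
- rewrite [LHS](YF false) /ycoef scaleN1r; congr (- _).
  by apply: eq_bigr => -[a1 a2] _.
- by rewrite [LHS](YF true) /ycoef; congr (_ *: _); apply: eq_bigr.
Qed.

End Oscillator.

(* Main.v *)
Require Import Defs.
From HB Require Import structures.
From mathcomp Require Import all_boot all_order all_algebra.
From mathcomp Require Import boolp reals.
From mathcomp Require Import complex.

(* Write D_a X_b = X_b D_a + S_ab for a <> b, where S_ab has coefficients in C.
   The operators D_a are odd and anticommute, T_ab anticommutes with D_c for c
   different from a and b, and D_a T_ab = - S_ab D_b.  In the induction step
     X_1..X_m D_1..D_m (X_(m+1) D_(m+1) + sum_a T_(a,m+1)),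
   moving X_(m+1) to the left through D_1..D_m produces the terms
   X_1..X_m D_1..S_(a,m+1)..D_m D_(m+1), which cancel X_1..X_m D_1..D_m T_(a,m+1).
   All this takes place in the tensor power of Q_J, J = N + M, which contains
   that of Q_N as a non-unital subalgebra; its unit is a product of idempotents
   absorbed on the right by D_1..D_n. *)

Set Implicit Arguments.
Unset Strict Implicit.
Unset Printing Implicit Defensive.

Import Order.TTheory GRing.Theory Num.Theory.
Local Open Scope ring_scope.
Local Open Scope complex_scope.

(** * The tensor powers of Q_J *)

Section QTensor.
Variables (J : finType) (A : superRingType).
Implicit Types (a c : A) (u : qten J A) (b : qbasis J).

(** The element $1\otimes a$ of $Q_J\otimes A$. *)
Definition qlift a : qten J A :=
  [ffun b => if ~~ b.1.1 && (b.1.2 == b.2) then a else 0].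

(** The factor [a] has to cross the basis vector [b], hence the twist by the parity of [b]. *)
Lemma qlift_mulE a u b : (qlift a * u) b = sgnb b.1.1 a * u b.
Proof.
case: b => [[x i] j]; rewrite ffunE /= big_bool /=.
rewrite [X in X + _]big1 ?add0r => [|r _]; last by rewrite ffunE sgnb0 mul0r.
rewrite (bigD1 i) //= big1 ?addr0 => [|r].
  by rewrite ffunE /= eqxx addbF.
by rewrite eq_sym ffunE /= => /negbTE ->; rewrite sgnb0 mul0r.
Qed.

Lemma qpure_mulE s p r a u b : (qpure (s, p, r) a * u) b =
  if b.1.2 == p then sgnb (b.1.1 (+) s) a * u (b.1.1 (+) s, r, b.2) else 0.
Proof.
case: b => [[x i] j]; rewrite ffunE /= (bigD1 s) //=.
rewrite [X in _ + X]big1 ?addr0 => [|t /negbTE ts]; last first.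
  by rewrite big1 // => k _; rewrite ffunE !xpair_eqE ts sgnb0 mul0r.
rewrite (bigD1 r) //= big1 ?addr0 => [|k /negbTE kr]; last first.
  by rewrite ffunE !xpair_eqE kr !andbF sgnb0 mul0r.
by rewrite ffunE !xpair_eqE !eqxx andbT /=; case: eqP; rewrite ?sgnb0 ?mul0r.
Qed.

Lemma qliftM : {morph qlift : a c / a * c}.
Proof.
move=> a c; apply/ffunP => b; rewrite qlift_mulE !ffunE.
by case: b => [[[] i] j] //=; rewrite ?mulr0 //; case: ifP; rewrite ?mulr0.
Qed.

Lemma qliftD : {morph qlift : a c / a + c}.
Proof. by move=> a c; apply/ffunP => b; rewrite !ffunE; case: ifP; rewrite ?addr0. Qed.

Lemma qlift0 : qlift 0 = 0.
Proof. by apply/ffunP => b; rewrite !ffunE; case: ifP. Qed.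

Lemma qliftN : {morph qlift : a / - a}.
Proof. by move=> a; apply: (addrI (qlift a)); rewrite -qliftD !subrr qlift0. Qed.

Lemma qlift1 : qlift 1 = 1.
Proof. by apply/ffunP => b; rewrite !ffunE; case: ifP. Qed.

Lemma qlift_sign (h : bool) a : qlift ((-1) ^+ h * a) = (-1) ^+ h * qlift a.
Proof. by case: h; rewrite ?mul1r // !mulN1r qliftN. Qed.

Lemma sgn_qlift a : sgn (qlift a) = qlift (sgn a).
Proof.
apply/ffunP => [[[x i] j]]; rewrite [LHS]ffunE !ffunE /=.
by case: x => /=; case: (i == j); rewrite ?sgn0 ?mulr0 ?mul1r.
Qed.

Lemma sgn_qpure b a : sgn (qpure b a) = (-1) ^+ b.1.1 * qpure b (sgn a).
Proof.
apply/ffunP => b'; rewrite [in RHS]mulr_sign [LHS]ffunE ffunE.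
have [->|hb] := eqVneq b' b.
  by rewrite mulr_sign; case: ifP; rewrite !ffunE eqxx.
by rewrite sgn0 mulr0; case: ifP; rewrite !ffunE (negbTE hb) ?oppr0.
Qed.

Lemma qpure_qlift b a c : qpure b a * qlift c = qpure b (a * c).
Proof.
case: b => [[s p] r]; apply/ffunP => [[[x i] j]]; rewrite qpure_mulE !ffunE /=.
rewrite !xpair_eqE [j == r]eq_sym; have -> : ~~ (x (+) s) = (x == s) by case: x s => [] [].
by case: (x =P s) => [->|_]; case: (i == p); case: (r == j); rewrite /= ?addbb ?mulr0.
Qed.

Lemma qlift_qpure b a c : qlift c * qpure b a = qpure b (sgnb b.1.1 c * a).
Proof.
apply/ffunP => b'; rewrite qlift_mulE !ffunE.
by case: eqP => [->|]; rewrite ?mulr0.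
Qed.

Lemma qpureN b a : qpure b (- a) = - qpure b a.
Proof. by apply/ffunP => b'; rewrite !ffunE; case: eqP; rewrite ?oppr0. Qed.

Lemma qpure_sign b (h : bool) a : qpure b ((-1) ^+ h * a) = (-1) ^+ h * qpure b a.
Proof. by case: h; rewrite ?mul1r // !mulN1r qpureN. Qed.

End QTensor.

Section TensorPower.
Variables (J : finType) (A : superRingType).
Implicit Types (a c : A) (b : qbasis J).

(** [tcoef] puts a coefficient behind identities, and [tunit] puts a basis vector into one position.
    All operators below become sums of products of these two, so that computations reduce to their
    exchange rules. *)
Definition tcoef n a : tpow J A n := ptens (fun=> None) a.
Definition tunit n (r : 'I_n) b : tpow J A n := tens1 r b 1.

Lemma tcoefS n a : tcoef n.+1 a = qlift J (tcoef n a).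
Proof. by []. Qed.

Lemma tens1_ord0 n b a : tens1 (ord0 : 'I_n.+1) b a = qpure b (tcoef n a).
Proof. by apply/ffunP => b'; rewrite !ffunE eqxx. Qed.

Lemma tens1_lift n (r : 'I_n) b a :
  tens1 (lift ord0 r) b a = qlift J (tens1 r b a).
Proof.
by apply/ffunP => b'; rewrite !ffunE; case: ifP.
Qed.

Lemma tens2_ord0 n (r' : 'I_n) b b' a :
  tens2 ord0 b (lift ord0 r') b' a = qpure b (tens1 r' b' a).
Proof.
by apply/ffunP => c; rewrite !ffunE.
Qed.

Lemma tens2_lift n (r r' : 'I_n) b b' a :
  tens2 (lift ord0 r) b (lift ord0 r') b' a = qlift J (tens2 r b r' b' a).
Proof.
by apply/ffunP => c; rewrite !ffunE; case: ifP.
Qed.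

Lemma tcoefD n : {morph tcoef n : a c / a + c}.
Proof. by elim: n => [|n IH] a c //; rewrite !tcoefS IH qliftD. Qed.

Lemma tcoefM n : {morph tcoef n : a c / a * c}.
Proof. by elim: n => [|n IH] a c //; rewrite !tcoefS IH qliftM. Qed.

Lemma tcoef0 n : tcoef n 0 = 0.
Proof. by elim: n => [|n IH] //; rewrite tcoefS IH qlift0. Qed.

Lemma tcoef1 n : tcoef n 1 = 1.
Proof. by elim: n => [|n IH] //; rewrite tcoefS IH qlift1. Qed.

Lemma tcoefN n : {morph tcoef n : a / - a}.
Proof. by elim: n => [|n IH] a //; rewrite !tcoefS IH qliftN. Qed.

Lemma tcoef_sign n (h : bool) a : tcoef n ((-1) ^+ h * a) = (-1) ^+ h * tcoef n a.
Proof. by case: h; rewrite ?mul1r // !mulN1r tcoefN. Qed.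

Lemma sgn_tcoef n a : sgn (tcoef n a) = tcoef n (sgn a).
Proof. by elim: n => [|n IH] //; rewrite !tcoefS -IH -sgn_qlift. Qed.

Lemma tunit_ord0 n b : tunit (ord0 : 'I_n.+1) b = qpure b 1.
Proof. by rewrite /tunit tens1_ord0 tcoef1. Qed.

Lemma tunit_lift n (r : 'I_n) b : tunit (lift ord0 r) b = qlift J (tunit r b).
Proof. exact: tens1_lift. Qed.

Lemma sgn_tunit n (r : 'I_n) b : sgn (tunit r b) = (-1) ^+ b.1.1 * tunit r b.
Proof.
elim: n r => [|n IH] r; first by case: r.
case: (unliftP ord0 r) => [r' ->|->].
  by rewrite tunit_lift (sgn_qlift J (tunit r' b)) IH qlift_sign.
by rewrite tunit_ord0 (@sgn_qpure J (tpow J A n)) sgn1.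
Qed.

Lemma tens1E n (r : 'I_n) b a : tens1 r b a = tunit r b * tcoef n a.
Proof.
elim: n r => [|n IH] r; first by case: r.
case: (unliftP ord0 r) => [r' ->|->].
  by rewrite tunit_lift tens1_lift IH tcoefS qliftM.
by rewrite tens1_ord0 tunit_ord0 tcoefS qpure_qlift mul1r.
Qed.

(** The vectors are multiplied in the order of their positions, so no sign arises; for [r > r'] two
    odd vectors would produce one. *)
Lemma tens2E n (r r' : 'I_n) b b' a : (r < r')%N ->
  tens2 r b r' b' a = tunit r b * tunit r' b' * tcoef n a.
Proof.
elim: n r r' => [|n IH] r r'; first by case: r.
case: (unliftP ord0 r') => [s' ->|->] //.
case: (unliftP ord0 r) => [s ->|-> _].
  rewrite ltnS => h; rewrite tens2_lift !tunit_lift IH // tcoefS.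
  by rewrite !qliftM.
by rewrite tens2_ord0 tunit_ord0 tunit_lift tcoefS qpure_qlift mul1r qpure_qlift -tens1E.
Qed.

Lemma tunitM n (r : 'I_n) s i j t k l :
  tunit r (s, i, j) * tunit r (t, k, l) =
  if j == k then tunit r (s (+) t, i, l) else 0.
Proof.
elim: n r => [|n IH] r; first by case: r.
case: (unliftP ord0 r) => [r' ->|->].
  rewrite !tunit_lift -qliftM IH; case: ifP => // _; exact: qlift0.
by rewrite !tunit_ord0 (@qpureM J (tpow J A n)) sgnb1 mulr1.
Qed.

(** The Koszul sign rule. It originates in the first tensor factor, where one vector sits and the
    other one, a lift, is carried past it. *)
Lemma tunitC n (r r' : 'I_n) b b' : r != r' ->
  tunit r b * tunit r' b' = (-1) ^+ (b.1.1 && b'.1.1) * (tunit r' b' * tunit r b).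
Proof.
elim: n r r' => [|n IH] r r'; first by case: r.
have sgE m (s : 'I_m) x (c : qbasis J) :
    sgnb x (tunit s c) = (-1) ^+ (x && c.1.1) * tunit s c.
  by case: x => //=; rewrite ?sgn_tunit ?mul1r.
case: (unliftP ord0 r) => [s ->|->]; case: (unliftP ord0 r') => [s' ->|->].
- rewrite (inj_eq (@lift_inj _ _)) => h; rewrite !tunit_lift -!qliftM IH //.
  exact: qlift_sign.
- move=> _; rewrite tunit_lift tunit_ord0 (@qlift_qpure J (tpow J A n)).
  rewrite (@qpure_qlift J (tpow J A n)) mulr1 mul1r sgE qpure_sign.
  by rewrite andbC.
- move=> _; rewrite tunit_lift tunit_ord0 (@qlift_qpure J (tpow J A n)).
  rewrite (@qpure_qlift J (tpow J A n)) mulr1 mul1r sgE qpure_sign.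
  by rewrite mulrA -signr_addb addbb mul1r.
- by rewrite eqxx.
Qed.

Lemma tcoef_tunit n (r : 'I_n) b a :
  tcoef n a * tunit r b = tunit r b * tcoef n (sgnb b.1.1 a).
Proof.
elim: n r => [|n IH] r; first by case: r.
case: (unliftP ord0 r) => [r' ->|->].
  by rewrite tunit_lift !tcoefS -!qliftM IH.
rewrite tunit_ord0 !tcoefS qlift_qpure qpure_qlift mul1r mulr1.
by case: b.1.1 => //=; rewrite sgn_tcoef.
Qed.

End TensorPower.

Lemma sgnb_tunit (J : finType) (A : superRingType) n (r : 'I_n) x (b : qbasis J) :
  sgnb x (tunit A r b) = (-1) ^+ (x && b.1.1) * tunit A r b.
Proof. by case: x => //=; rewrite ?sgn_tunit ?mul1r. Qed.

Lemma sgnb_tcoef (J : finType) (A : superRingType) n x (a : A) :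
  sgnb x (tcoef J n a) = tcoef J n (sgnb x a).
Proof. by case: x => //=; rewrite sgn_tcoef. Qed.

Lemma raddf_sign (A B : pzRingType) (f : {additive A -> B}) (h : bool) x :
  f ((-1) ^+ h * x) = (-1) ^+ h * f x.
Proof. by case: h; rewrite ?mul1r // !mulN1r raddfN. Qed.

(** * Functoriality of the tensor powers *)

Section MapQTensor.
Variables (J K : finType) (A B : superRingType) (f : {additive A -> B}).
Let JK : finType := (J + K)%type.

(** [qmap] and, below, [qemb] are one recursion step of [tmap] and [temb], with an additive [f] in
    place of the recursive call. *)
Definition qmap (u : qten J A) : qten J B := [ffun b => f (u b)].

Definition qinl (b : qbasis J) : qbasis JK := (b.1.1, inl b.1.2, inl b.2).

Definition qemb (u : qten J A) : qten JK B :=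
  [ffun b : qbasis JK =>
     match b.1.2, b.2 return B with inl i, inl j => f (u (b.1.1, i, j)) | _, _ => 0 end].

Lemma qmapB : {morph qmap : u v / u - v}.
Proof. by move=> u v; apply/ffunP => b; rewrite !ffunE raddfB. Qed.

Lemma qembB : {morph qemb : u v / u - v}.
Proof.
move=> u v; apply/ffunP => -[[s [i|i]] [j|j]]; rewrite !ffunE /= ?subrr //.
by rewrite !ffunE raddfB.
Qed.

(** Left multiplication by $1\otimes a$ twists [a] at the odd entries, so the hypothesis has to
    cover both [a] and [sgn a]. *)
Lemma qmap_qlift a a' u :
  (forall x c, f (sgnb x a * c) = sgnb x a' * f c) ->
  qmap (qlift J a * u) = qlift J a' * qmap u.
Proof.
by move=> h; apply/ffunP => b; rewrite ffunE !qlift_mulE ffunE h.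
Qed.

Lemma qemb_qlift a a' u :
  (forall x c, f (sgnb x a * c) = sgnb x a' * f c) ->
  qemb (qlift J a * u) = qlift JK a' * qemb u.
Proof.
move=> h; apply/ffunP => -[[s [i|i]] [j|j]];
  by rewrite ffunE !qlift_mulE ffunE /= ?mulr0 // qlift_mulE h.
Qed.

Lemma qmap_qpure b u : qmap (qpure b 1 * u) = qpure b 1 * qmap u.
Proof.
case: b => [[s i] j]; apply/ffunP => c.
rewrite ffunE !qpure_mulE !sgnb1 !mul1r ffunE.
by case: eqP; rewrite ?raddf0.
Qed.

Lemma qemb_qpure b u : qemb (qpure b 1 * u) = qpure (qinl b) 1 * qemb u.
Proof.
case: b => [[s i] j]; apply/ffunP => -[[t [k|k]] [l|l]];
  rewrite ffunE /qinl !qpure_mulE !sgnb1 !mul1r ffunE /= ?if_same //.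
rewrite qpure_mulE sgnb1 mul1r /= (inj_eq (@inl_inj J K)).
by case: eqP; rewrite ?raddf0.
Qed.

Lemma qmap1 : f 1 = 1 -> qmap 1 = 1.
Proof.
move=> h; apply/ffunP => b; rewrite !ffunE.
by case: (~~ _ && _); rewrite ?h ?raddf0.
Qed.

(** The unit of $Q_J$ becomes the sum of the idempotents $e_{kk}$ of its block, in general not the
    unit of the larger algebra. *)
Lemma qemb1 : qemb 1 =
  \sum_(k : J) qpure (qinl (eb k k)) 1 * qlift JK (f 1).
Proof.
apply/ffunP => b; rewrite sum_ffunE.
under eq_bigr => k _ do rewrite qpure_mulE !ffunE /= sgnb1 mul1r addbF.
case: b => [[s [i|i]] [j|j]]; rewrite ffunE /=.
- rewrite (bigD1 i) //= eqxx big1 ?addr0 => [|k]; last first.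
    by rewrite eq_sym (inj_eq (@inl_inj J K)) => /negbTE ->.
  rewrite ffunE (inj_eq (@inl_inj J K)) /=.
  by case: (~~ _ && _); rewrite ?raddf0.
- by rewrite big1 // => k _; rewrite andbF if_same.
- by rewrite big1.
- by rewrite big1 // => k _; rewrite andbF if_same.
Qed.

End MapQTensor.

Section MapTensor.
Variables (J : finType) (A B : superRingType) (phi : {rmorphism A -> B}).

Lemma tmapB n : {morph @tmap J A B phi n : u v / u - v}.
Proof.
elim: n => [|n IH]; first exact: rmorphB.
pose f : {additive _ -> _} :=
  HB.pack (@tmap J A B phi n) (GRing.isZmodMorphism.Build _ _ _ IH).
exact: (qmapB f).
Qed.

HB.instance Definition _ n :=
  GRing.isZmodMorphism.Build _ _ (@tmap J A B phi n) (@tmapB n).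

Lemma tmap1 n : @tmap J A B phi n 1 = 1.
Proof. by elim: n => [|n IH]; [exact: rmorph1 | exact: (@qmap1 J _ _ (@tmap J A B phi n) IH)]. Qed.

Lemma tmap_tunit n (r : 'I_n) (b : qbasis J) (u : tpow J A n) :
  tmap phi (tunit A r b * u) = tunit B r b * tmap phi u.
Proof.
elim: n r u => [|n IH] r u; first by case: r.
case: (unliftP ord0 r) => [r' ->|->]; last first.
  by rewrite !tunit_ord0; exact: (@qmap_qpure J _ _ (@tmap J A B phi n)).
rewrite !tunit_lift; apply: (@qmap_qlift J _ _ (@tmap J A B phi n)) => x c.
by rewrite !sgnb_tunit -!mulrA raddf_sign /= IH.
Qed.

(** Carrying [a] past odd basis vectors applies [sgn]. As [phi] is not assumed to preserve parity,
    this is required at the single element [a]. *)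
Lemma tmap_tcoef n (a : A) (u : tpow J A n) : phi (sgn a) = sgn (phi a) ->
  tmap phi (tcoef J n a * u) = tcoef J n (phi a) * tmap phi u.
Proof.
elim: n a u => [|n IH] a u ha; first exact: rmorphM.
rewrite !tcoefS; apply: (@qmap_qlift J _ _ (@tmap J A B phi n)) => x c; rewrite !sgnb_tcoef /= IH.
  by case: x => /=; rewrite ?ha.
by case: x => //=; rewrite sgnK ha sgnK.
Qed.

End MapTensor.

Section EmbTensor.
Variables (J K : finType) (A : superRingType).
Let JK : finType := (J + K)%type.

Lemma tembB n : {morph @temb J K A n : u v / u - v}.
Proof.
elim: n => [|n IH] //.
pose f : {additive _ -> _} :=
  HB.pack (@temb J K A n) (GRing.isZmodMorphism.Build _ _ _ IH).
exact: (@qembB J K _ _ f).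
Qed.

HB.instance Definition _ n :=
  GRing.isZmodMorphism.Build _ _ (@temb J K A n) (@tembB n).

Lemma temb_tunit n (r : 'I_n) (b : qbasis J) (u : tpow J A n) :
  temb K (tunit A r b * u) = tunit A r (qinl K b) * temb K u.
Proof.
elim: n r u => [|n IH] r u; first by case: r.
case: (unliftP ord0 r) => [r' ->|->]; last first.
  by rewrite !tunit_ord0; exact: (@qemb_qpure J K _ _ (@temb J K A n)).
rewrite !tunit_lift; apply: (@qemb_qlift J K _ _ (@temb J K A n)) => x c.
by rewrite !sgnb_tunit -!mulrA raddf_sign /= IH.
Qed.

Lemma temb_tcoef n (a : A) (u : tpow J A n) :
  temb K (tcoef J n a * u) = tcoef JK n a * temb K u.
Proof.
elim: n a u => [|n IH] a u //.
by rewrite !tcoefS; apply: (@qemb_qlift J K _ _ (@temb J K A n)) => x c; rewrite !sgnb_tcoef /= IH.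
Qed.

Lemma temb1 n : temb K (1 : tpow J A n) =
  \prod_(r < n) \sum_(k : J) tunit A r (qinl K (eb k k)).
Proof.
elim: n => [|n IH]; first by rewrite big_ord0.
rewrite big_ord_recl.
(* In the positions after the first all idempotents are lifts; [qlift] is pulled out of the sums and
   of the product to reach the induction hypothesis. *)
under [X in _ * X]eq_bigr => r _.
  under eq_bigr => k _ do rewrite tunit_lift.
  rewrite -(big_morph _ (@qliftD JK _) (@qlift0 JK _)).
  over.
rewrite -(big_morph _ (@qliftM JK _) (@qlift1 JK _)) -IH.
under eq_bigr => k _ do rewrite tunit_ord0.
by rewrite mulr_suml; exact: (@qemb1 J K _ _ (@temb J K A n)).
Qed.

End EmbTensor.

(** * Normal ordering *)

Section NormalOrdering.
Variables (R : pzRingType) (n : nat) (X D : nat -> R) (T S : nat -> nat -> R).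
Hypothesis DD : forall a b, (a < b < n)%N -> D a * D b = - (D b * D a).
Hypothesis DX : forall a b, (a < b < n)%N -> D a * X b = X b * D a + S a b.
Hypothesis DT : forall a b, (a < b < n)%N -> D a * T a b = - (S a b * D b).
Hypothesis DTC : forall a c b, (a < c < b)%N -> (b < n)%N ->
  D c * T a b = - (T a b * D c).

Lemma prodD_anticomm (y : R) i j :
  (forall c, (i <= c < j)%N -> D c * y = - (y * D c)) ->
  \prod_(i <= c < j) D c * y = (-1) ^+ (j - i) * y * \prod_(i <= c < j) D c.
Proof.
elim: j => [|k IH] h; first by rewrite !big_geq // mul1r mulr1.
(* For [k < i] the product is empty and the truncated exponent [k.+1 - i] is 0. *)
have [ik|ki] := leqP i k; last first.
  by move: (ki); rewrite -subn_eq0 => /eqP ->; rewrite !big_geq // mul1r mulr1.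
 rewrite !big_nat_recr //= -mulrA h ?ik ?leqnn //.
rewrite mulrN mulrA IH => // [|c /andP [h1 h2]]; last by rewrite h // h1 ltnW.
by rewrite subSn // exprS mulN1r !mulNr !mulrA.
Qed.

(** [T a b] moves left past the factors strictly between [a] and [b] and meets [D a], which gives
    [- (S a b * D b)]; then [D b] moves right past the same factors, and the two signs
    $(-1)^{b-a-1}$ cancel. *)
Lemma prodD_T a b : (a < b < n)%N ->
  \prod_(0 <= c < b) D c * T a b =
  - (\prod_(0 <= c < a) D c * S a b * \prod_(a.+1 <= c < b) D c * D b).
Proof.
move=> /andP [ab bn]; have hab : (a < b < n)%N by rewrite ab.
rewrite (big_cat_nat (n := a)) ?(ltnW ab) //= [\prod_(a <= c < b) _]big_ltn // -!mulrA.
rewrite prodD_anticomm => [|c /andP [h1 h2]]; last by rewrite DTC // h1.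
rewrite (prodD_anticomm (y := D b)) => [|c /andP [h1 h2]]; last by rewrite DD ?h2.
have sC x : (-1) ^+ (b - a.+1) * x = x * (-1) ^+ (b - a.+1) :> R.
  exact: commr_sym (commr_sign _ _).
rewrite sC -!mulrA [D a * (T a b * _)]mulrA DT // !mulNr !mulrN.
by rewrite -!mulrA [D b * (_ * _)]mulrA -sC -mulrA.
Qed.

(** Each [D a] that [X b] crosses leaves a term in which [D a] is replaced by [S a b]. Only [b = m]
    is used later, but the induction on [m] needs [b] fixed. *)
Lemma prodD_X b m : (m <= b < n)%N ->
  \prod_(0 <= c < m) D c * X b = X b * \prod_(0 <= c < m) D c +
  \sum_(0 <= a < m) \prod_(0 <= c < a) D c * S a b * \prod_(a.+1 <= c < m) D c.
Proof.
move=> /andP [mb bn]; elim: m mb => [|m IH] mb.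
  by rewrite !big_geq // mul1r mulr1 addr0.
rewrite [\prod_(0 <= c < m.+1) D c](big_nat_recr m) //=.
rewrite [X in _ = _ + X](big_nat_recr m) //= -mulrA DX ?mb // mulrDr mulrA IH ?(ltnW mb) //.
rewrite mulrDl -!addrA mulrA; congr (_ + _).
rewrite [\prod_(m.+1 <= c < m.+1) _]big_geq // mulr1; congr (_ + _).
rewrite mulr_suml !big_nat; apply: eq_bigr => a /andP [_ am].
by rewrite [in RHS]big_nat_recr //= !mulrA.
Qed.

Lemma normal_ordering : \prod_(0 <= b < n) (X b * D b + \sum_(0 <= a < b) T a b) =
  \prod_(0 <= b < n) X b * \prod_(0 <= b < n) D b.
Proof.
(* The lengths of the products become [m], while [n] still bounds the indices in the hypotheses. *)
have: (n <= n)%N by []. move: {1 3 4 5}n => m.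
elim: m => [|m IH] mn; first by rewrite !big_geq // mulr1.
rewrite !(big_nat_recr m) //= IH ?(ltnW mn) // mulrDr.
rewrite -mulrA [X in _ * X + _]mulrA prodD_X ?leqnn // mulrDl mulrDr.
rewrite -addrA -[RHS]addr0 !mulrA; congr (_ + _).
(* Behind the common factor of the [X], the commutator terms cancel the [T a m] one [a] at a
   time. *)
rewrite -!mulrA -mulrDr [X in _ * X](_ : _ = 0) ?mulr0 //.
rewrite mulr_suml mulr_sumr -big_split /= big_nat big1 // => a /andP [_ am].
by rewrite prodD_T ?am // subrr.
Qed.

End NormalOrdering.

(** * The operators X and D *)

Lemma big_pair3 (V : nmodType) (I1 I2 I3 : finType) (F : I1 * I2 * I3 -> V) :
  \sum_p F p = \sum_i \sum_j \sum_k F (i, j, k).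
Proof.
rewrite (eq_bigr (fun p => F (p.1.1, p.1.2, p.2))); last by case=> [[]].
rewrite -(pair_bigA _ (fun ij k => F (ij.1, ij.2, k))) /=.
by rewrite -(pair_bigA _ (fun i j => \sum_k F (i, j, k))).
Qed.

Lemma sum_delta (V : nmodType) (I : finType) (i : I) (F : I -> V) :
  \sum_j (if i == j then F j else 0) = F i.
Proof.
rewrite (bigD1 i) //= eqxx big1 ?addr0 // => j /negbTE.
by rewrite eq_sym => ->.
Qed.

(** [p r] commutes with everything to the right of the last [D r] in the product, and that factor
    absorbs it. *)
Lemma prod_absorb (R : pzRingType) (I : eqType) (D p : I -> R) (s : seq I) r :
  (forall i j, i != j -> D i * p j = p j * D i) ->
  (forall i, D i * p i = D i) ->
  r \in s -> \prod_(i <- s) D i * p r = \prod_(i <- s) D i.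
Proof.
move=> hC h; elim: s => // i s IH; rewrite in_cons big_cons -mulrA.
have [rs _|rs] := boolP (r \in s); first by rewrite IH.
rewrite orbF => /eqP er; rewrite {IH} -er; move: rs.
suff E : r \notin s -> \prod_(j <- s) D j * p r = p r * \prod_(j <- s) D j.
  by move=> /E ->; rewrite mulrA h.
elim: s => [|j s IH]; first by rewrite big_nil mul1r mulr1.
rewrite in_cons negb_or eq_sym => /andP [hj hs].
by rewrite !big_cons -mulrA IH // !mulrA hC.
Qed.

(** * Parities and commutation relations of the entries of X and D *)

Section Coefficients.
Variables (C : numClosedFieldType) (M N : nat).

Lemma homogeneousZ (A : superAlgType C) p c (x : A) :
  homogeneous p x -> homogeneous p (c *: x).
Proof. by rewrite /homogeneous sgnZ => ->; rewrite scalerAr. Qed.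

Lemma homogeneousN (A : superRingType) p (x : A) :
  homogeneous p x -> homogeneous p (- x).
Proof. by rewrite /homogeneous sgnN => ->; rewrite mulrN. Qed.

Lemma homogeneous_sum (A : superRingType) p I (r : seq I) (F : I -> A) :
  (forall i, homogeneous p (F i)) -> homogeneous p (\sum_(i <- r) F i).
Proof.
by move=> h; rewrite /homogeneous sgn_sum mulr_sumr; apply: eq_bigr => i _; exact: h.
Qed.

Lemma sign_alg (A : algType C) (h : bool) (x : A) :
  (-1) ^+ h *: x = (-1) ^+ h * x.
Proof. by case: h; rewrite ?scale1r ?mul1r ?scaleN1r ?mulN1r. Qed.

Lemma homogeneous_px a k : homogeneous a.1 (px C a k : PD C M N).
Proof. by rewrite /homogeneous /px /tgen [LHS]tsgE /= tpiZ sign_alg. Qed.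

Lemma homogeneous_pd k a : homogeneous a.1 (pd C k a : PD C M N).
Proof. by rewrite /homogeneous /pd /tgen [LHS]tsgE /= tpiZ sign_alg. Qed.

Lemma homogeneous_UF i j : homogeneous (i.1 (+) j.1) (UF C i j : Uq C N).
Proof. by rewrite /homogeneous /UF /tgen [LHS]tsgE /= tpiZ sign_alg. Qed.

(** The entries of X, and in [dcoef] those of D, at the matrix unit of parity [s]; one formula then
    serves for the $e$ and the $f$. As X is even and D odd, these entries have parity [s] and
    [~~ s]. *)
Definition xcoef (s : bool) (a : 'I_M) (k : 'I_N) : PD C M N :=
  if s then - ('i *: px C (neg a) k) else px C (pos a) k.

Definition dcoef (s : bool) (k : 'I_N) (a : 'I_M) : PD C M N :=
  if s then pd C k (pos a) else 'i *: pd C k (neg a).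

Lemma homogeneous_xcoef s a k : homogeneous s (xcoef s a k).
Proof.
case: s => /=; last exact: homogeneous_px.
by apply/homogeneousN/homogeneousZ/homogeneous_px.
Qed.

Lemma homogeneous_dcoef s k a : homogeneous (~~ s) (dcoef s k a).
Proof.
case: s => /=; first exact: homogeneous_pd.
exact/homogeneousZ/homogeneous_pd.
Qed.

Lemma dcoef_dcoef s k a t l b :
  dcoef s k a * dcoef t l b = (-1) ^+ (~~ s && ~~ t) * (dcoef t l b * dcoef s k a).
Proof.
have E u v := @DdDd C M N u v; rewrite /Dd in E.
by case: s t => [] []; rewrite /dcoef /pd -?scalerAl -?scalerAr E sign_alg //=
  ?mul1r ?mulN1r ?scalerN // scalerA.
Qed.

(** The factors $\mathrm i$ of D and $-\mathrm i$ of X multiply to 1, so both kinds of conjugate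
    pairs contribute the same constant. *)
Lemma dcoef_xcoef s k a t b l : dcoef s k a * xcoef t b l =
  ([&& s != t, a == b & k == l])%:R + (-1) ^+ (~~ s && t) * (xcoef t b l * dcoef s k a).
Proof.
have E u v := @DdDx C M N u v; rewrite /Dd /Dx in E.
have i2 : 'i * 'i = -1 :> C by rewrite -expr2 sqrCi.
case: s t => [] []; rewrite /dcoef /xcoef /px /pd ?mulrN ?mulNr -?scalerAl -?scalerAr E sign_alg /=;
  rewrite /xpar /= ?xpair_eqE /= ?expr0 ?expr1 ?mul1r ?mulN1r ?scaler_nat ?scale0r ?add0r //.
by rewrite scaleN1r !scalerA i2 !scaleN1r !opprK.
Qed.

End Coefficients.

Section TensorProducts.
Variables (J : finType) (A : superRingType) (n : nat).
Implicit Types (r : 'I_n) (b : qbasis J) (x y : A).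

Lemma tcoef_tunit_homogeneous p r b x : homogeneous p x ->
  tcoef J n x * tunit A r b = (-1) ^+ (p && b.1.1) * (tunit A r b * tcoef J n x).
Proof.
move=> hx; rewrite tcoef_tunit (sgnb_homogeneous _ hx) tcoef_sign andbC.
by rewrite mulrA (commr_sign (tunit A r b)) mulrA.
Qed.

Lemma tpureM p r b x r' b' y : homogeneous p x ->
  tunit A r b * tcoef J n x * (tunit A r' b' * tcoef J n y) =
  (-1) ^+ (p && b'.1.1) * (tunit A r b * tunit A r' b' * tcoef J n (x * y)).
Proof.
move=> hx; rewrite -mulrA [tcoef J n x * _]mulrA (tcoef_tunit_homogeneous _ _ hx).
rewrite -!mulrA mulrA (commr_sign (tunit A r b)) -mulrA tcoefM.
by rewrite !mulrA.
Qed.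

End TensorProducts.

(** * Exchange relations of X, D and T in the tensor power *)

Section Operators.
Variables (C : numClosedFieldType) (M N n : nat).
Let J : finType := ('I_N + 'I_M)%type.
Local Notation W := (tpow J (PD C M N) n).
Local Notation U := (tunit (PD C M N)).
Local Notation K := (tcoef J n).
Local Notation X := (@Xop C M N n).
Local Notation D := (@Dop C M N n).
Implicit Types (r a b c : 'I_n).

Definition idN (k : 'I_N) : J := inl k.
Definition idM (i : 'I_M) : J := inr i.

Lemma XopE r : X r = \sum_(p : bool * 'I_M * 'I_N)
  U r (p.1.1, idN p.2, idM p.1.2) * K (xcoef C p.1.1 p.1.2 p.2).
Proof.
rewrite big_pair3 big_bool /= -big_split; apply: eq_bigr => a _.
rewrite -big_split; apply: eq_bigr => k _ /=.
by rewrite !tens1E addrC tcoefN mulrN.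
Qed.

Lemma DopE r : D r = \sum_(p : bool * 'I_M * 'I_N)
  U r (p.1.1, idM p.1.2, idN p.2) * K (dcoef C p.1.1 p.2 p.1.2).
Proof.
rewrite big_pair3 big_bool /= -big_split; apply: eq_bigr => a _.
rewrite -big_split; apply: eq_bigr => k _ /=.
by rewrite !tens1E addrC.
Qed.

(* The image of [Tab a b], but with the identity of Q_J instead of that of Q_N
   in the other factors. *)
Definition TabJ a b : W := \sum_(p : bool * 'I_N * 'I_N)
  (-1) ^+ (~~ p.1.1) *
  (U a (p.1.1, idN p.1.2, idN p.2) * U b (~~ p.1.1, idN p.2, idN p.1.2)).

(** The element $S_{ab}$. It is the formula of [TabJ] with the outer index in ['I_M] instead of
    ['I_N]; the sign arises when an entry of $D_a$ of parity [~~ s] crosses a matrix unit of the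
    same parity. *)
Definition commDX a b : W := \sum_(p : bool * 'I_M * 'I_N)
  (-1) ^+ (~~ p.1.1) *
  (U a (p.1.1, idM p.1.2, idN p.2) * U b (~~ p.1.1, idN p.2, idM p.1.2)).

(** The identity of $Q_N$ in position [r], an idempotent of $Q_J$. *)
Definition projN r : W := \sum_(k < N) U r (eb (idN k) (idN k)).

(** Every summand of D is odd, and derivatives supercommute; for all parities [s] and [t] the signs
    combine to $-1$. *)
Lemma Dop_anticomm a b : a != b -> D a * D b = - (D b * D a).
Proof.
move=> ab; rewrite !DopE !big_distrlr /= exchange_big -sumrN /=.
apply: eq_bigr => -[[t j] l] _; rewrite -sumrN; apply: eq_bigr => -[[s i] k] _ /=.
rewrite !(tpureM _ _ _ _ _ (homogeneous_dcoef _ _ _ _)) /=.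
rewrite (tunitC _ _ _ ab) dcoef_dcoef tcoef_sign /=.
by case: s t => [] []; rewrite /= ?expr0 ?expr1 ?mulN1r ?mul1r ?mulNr ?mulrN ?opprK.
Qed.

Lemma Dop_Xop a b : a != b -> D a * X b = X b * D a + commDX a b.
Proof.
move=> ab; rewrite DopE XopE !big_distrlr /= [X in _ = X + _]exchange_big -big_split /=.
apply: eq_bigr => -[[s i] k] _ /=.
set m := (-1) ^+ (~~ s) * _.
(* The summand of [commDX] is written as a sum concentrated at one index of X, so that both sides
   are compared term by term. *)
rewrite -[m](sum_delta (~~ s, i, k) (fun=> m)) -big_split.
apply: eq_bigr => -[[t j] l] _ /=.
rewrite (tpureM _ _ _ _ _ (homogeneous_dcoef _ _ _ _)).
rewrite (tpureM _ _ _ _ _ (homogeneous_xcoef _ _ _ _)) /=.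
rewrite dcoef_xcoef tcoefD mulrDr mulrDr [RHS]addrC; congr (_ + _); last first.
  rewrite (tunitC _ _ _ ab) tcoef_sign /=.
  by case: (s) (t) => [] []; rewrite /= ?expr0 ?expr1 ?mulN1r ?mul1r ?mulNr ?mulrN ?opprK.
rewrite !xpair_eqE; have -> : (~~ s == t) = (s != t) by case: (s) (t) => [] [].
rewrite -andbA; case: ifP => [/and3P [st /eqP <- /eqP <-]|_].
  by rewrite tcoef1 mulr1 /m; case: (s) (t) st => [] [].
by rewrite tcoef0 !mulr0.
Qed.

(** Four exchanges have the sign exponents [s && t], [s && ~~ t], [~~ s && t] and [~~ s && ~~ t],
    exactly one of which is true. *)
Lemma Dop_TabJ_anticomm a b c : c != a -> c != b -> D c * TabJ a b = - (TabJ a b * D c).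
Proof.
move=> ca cb; rewrite DopE !big_distrlr /= exchange_big -sumrN /=.
apply: eq_bigr => -[[t k'] l] _; rewrite -sumrN; apply: eq_bigr => -[[s i] k] _ /=.
set u := U a _; set v := U b _; set w := U c _; set x := K _.
have xu : x * u = (-1) ^+ (~~ s && t) * (u * x).
  exact: tcoef_tunit_homogeneous (homogeneous_dcoef _ _ _ _).
have xv : x * v = (-1) ^+ (~~ s && ~~ t) * (v * x).
  exact: tcoef_tunit_homogeneous (homogeneous_dcoef _ _ _ _).
have wu : w * u = (-1) ^+ (s && t) * (u * w) by exact: tunitC.
have wv : w * v = (-1) ^+ (s && ~~ t) * (v * w) by exact: tunitC.
have wxuv : w * x * (u * v) = - (u * v * (w * x)).
  rewrite -mulrA [x * (u * v)]mulrA xu -[_ * (u * x) * v]mulrA -[u * x * v]mulrA xv.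
  case: (s) (t) wu wv => [] [] /=; rewrite ?expr0 ?expr1 ?mul1r ?mulN1r ?mulrN ?mulNr => wu wv;
    by rewrite !mulrA wu ?mulNr -?[u * w * v]mulrA wv ?mulrN ?mulNr ?opprK !mulrA.
by case: (t) wxuv => wxuv; rewrite /= ?expr0 ?expr1 ?mul1r ?mulN1r ?mulrN ?mulNr wxuv.
Qed.

(** Contracting indices in position [a] on the left and in position [b] on the right produces the
    same terms with opposite signs, $(-1)^t$ in [E1] and $(-1)^{t+1}$ in [E2]. *)
Lemma Dop_TabJ a b : a != b -> D a * TabJ a b = - (commDX a b * D b).
Proof.
move=> ab; rewrite DopE /TabJ /commDX (DopE b) !big_distrlr /= [in RHS]exchange_big -sumrN /=.
(* Shifting the parity in [TabJ] by [s] makes [t] the parity of the vector in position [a] on both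
   sides. *)
apply: eq_bigr => -[[s i] k] _ /=; rewrite !big_pair3 /= [LHS](reindex_inj (@addbI s)) /=.
rewrite -sumrN; apply: eq_bigr => t _.
have E1 k' l : U a (s, idM i, idN k) * K (dcoef C s k i) *
    ((-1) ^+ (~~ (s (+) t)) *
     (U a (s (+) t, idN k', idN l) * U b (~~ (s (+) t), idN l, idN k'))) =
    if k == k' then (-1) ^+ t * (U a (t, idM i, idN l) *
      U b (~~ (s (+) t), idN l, idN k) * K (dcoef C s k i)) else 0.
  set w := U a _; set x := K _; set u := U a (_, idN k', _); set v := U b _.
  have xu : x * u = (-1) ^+ (~~ s && (s (+) t)) * (u * x).
    exact: tcoef_tunit_homogeneous (homogeneous_dcoef _ _ _ _).
  have xv : x * v = (-1) ^+ (~~ s && ~~ (s (+) t)) * (v * x).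
    exact: tcoef_tunit_homogeneous (homogeneous_dcoef _ _ _ _).
  have wu : w * u = if k == k' then U a (t, idM i, idN l) else 0.
    by rewrite /w /u tunitM addbA addbb.
  have wxuv : w * x * (u * v) = (-1) ^+ (~~ s) * (w * u * v * x).
    rewrite -mulrA [x * (u * v)]mulrA xu -[_ * (u * x) * v]mulrA -[u * x * v]mulrA xv.
    by case: (s) (t) => [] [] /=;
      rewrite ?expr0 ?expr1 ?mul1r ?mulN1r ?mulrN ?mulNr !mulrA.
  rewrite [LHS]mulrA commr_sign -[LHS]mulrA wxuv wu mulrA -signr_addb.
  rewrite addbN addNb negbK addbAC addbb /= /v.
  by case: eqP => [<-|_]; rewrite ?mul0r ?mulr0.
have E2 i' l : (-1) ^+ (~~ t) * (U a (t, idM i', idN l) * U b (~~ t, idN l, idM i')) *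
    (U b (s, idM i, idN k) * K (dcoef C s k i)) =
    if i == i' then (-1) ^+ (~~ t) * (U a (t, idM i, idN l) *
      U b (~~ (s (+) t), idN l, idN k) * K (dcoef C s k i)) else 0.
  rewrite -!mulrA [U b _ * (U b _ * _)]mulrA tunitM (inj_eq (@inr_inj _ _)) eq_sym.
  case: eqP => [<-|_]; last by rewrite !mul0r !mulr0.
  by rewrite addbC addbN.
under eq_bigr => k' _ do under eq_bigr => l _ do rewrite E1.
under [in RHS]eq_bigr => i' _ do under eq_bigr => l _ do rewrite E2.
rewrite exchange_big [in RHS]exchange_big -sumrN; apply: eq_bigr => l _ /=.
rewrite !sum_delta; case: (t); by rewrite /= ?expr0 ?expr1 ?mul1r ?mulN1r ?opprK.
Qed.

Lemma Dop_projN r : D r * projN r = D r.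
Proof.
rewrite DopE /projN big_distrlr /=; apply: eq_bigr => -[[s i] k] _ /=.
rewrite -[RHS](sum_delta k (fun=> _)); apply: eq_bigr => l _.
rewrite -mulrA (tcoef_tunit_homogeneous _ _ (homogeneous_dcoef _ _ _ _)) andbF mul1r.
rewrite mulrA tunitM (inj_eq (@inl_inj _ _)) addbF.
by case: eqP => [->|_]; rewrite ?mul0r.
Qed.

Lemma projN_Dop a b : a != b -> D a * projN b = projN b * D a.
Proof.
move=> ab; rewrite DopE /projN !big_distrlr /= exchange_big; apply: eq_bigr => l _.
apply: eq_bigr => -[[s i] k] _ /=.
rewrite -mulrA (tcoef_tunit_homogeneous _ _ (homogeneous_dcoef _ _ _ _)) andbF mul1r.
by rewrite mulrA (tunitC _ _ _ ab) andbF mul1r mulrA.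
Qed.

Lemma prod_Dop_projN : \prod_(r < n) D r * \prod_(r < n) projN r = \prod_(r < n) D r.
Proof.
have: {subset index_enum 'I_n <= index_enum 'I_n} by [].
(* Only the list of idempotents is generalised; they are absorbed one by one by the full product of
   the [Dop]. *)
move: {1 4}(index_enum 'I_n) => t; elim: t => [|r t IH] ht.
  by rewrite big_nil mulr1.
rewrite big_cons mulrA (prod_absorb projN_Dop Dop_projN) ?ht ?mem_head //.
by rewrite IH // => i hi; rewrite ht // in_cons hi orbT.
Qed.

(** This is $G\mapsto XD$ entry by entry: the coefficients are the prescribed images of $F_{l,-k}$
    and $-F_{lk}$. *)
Lemma Xop_Dop r : X r * D r = \sum_k \sum_l
  (U r (eb (idN k) (idN l)) * K ('i *: \sum_(a : sidx M) px C a k * pd C l (sopp a)) +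
   U r (fb (idN k) (idN l)) * K (\sum_(a : sidx M) px C a k * pd C l a)).
Proof.
have i2 : 'i * 'i = -1 :> C by rewrite -expr2 sqrCi.
have sE (F : sidx M -> PD C M N) : \sum_a F a = \sum_i (F (neg i) + F (pos i)).
  rewrite (eq_bigr (fun p => F (p.1, p.2))); last by case.
  by rewrite -(pair_bigA _ (fun s i => F (s, i))) big_bool -big_split.
have KE (F : 'I_M -> PD C M N) : K (\sum_i F i) = \sum_i K (F i).
  exact: (big_morph _ (@tcoefD _ _ _) (@tcoef0 _ _ _)).
rewrite XopE DopE big_distrlr /=.
transitivity (\sum_k \sum_l \sum_i \sum_(s : bool) \sum_(t : bool)
  (-1) ^+ (s && t) * (U r (s (+) t, idN k, idN l) *
    K (xcoef C s i k * dcoef C t l i))).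
  have E (p : bool * 'I_M * 'I_N) : \sum_(q : bool * 'I_M * 'I_N)
      U r (p.1.1, idN p.2, idM p.1.2) * K (xcoef C p.1.1 p.1.2 p.2) *
      (U r (q.1.1, idM q.1.2, idN q.2) * K (dcoef C q.1.1 q.2 q.1.2)) =
      \sum_l \sum_(t : bool) (-1) ^+ (p.1.1 && t) *
        (U r (p.1.1 (+) t, idN p.2, idN l) *
         K (xcoef C p.1.1 p.1.2 p.2 * dcoef C t l p.1.2)).
    case: p => [[s i] k]; rewrite big_pair3 [RHS]exchange_big; apply: eq_bigr => t _.
    rewrite exchange_big; apply: eq_bigr => l _ /=.
    rewrite -[RHS](sum_delta i (fun=> _)); apply: eq_bigr => j _.
    rewrite (tpureM _ _ _ _ _ (homogeneous_xcoef _ _ _ _)) tunitM (inj_eq (@inr_inj _ _)).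
    by case: eqP => [->|_]; rewrite ?mul0r ?mulr0.
  rewrite (eq_bigr _ (fun p _ => E p)) big_pair3 /=.
  under eq_bigr => s _ do rewrite exchange_big /=.
  rewrite exchange_big /=; apply: eq_bigr => k _.
  under eq_bigr => s _ do rewrite exchange_big /=.
  rewrite exchange_big /=; apply: eq_bigr => l _.
  exact: exchange_big.
apply: eq_bigr => k _; apply: eq_bigr => l _.
rewrite !sE scaler_sumr !KE !mulr_sumr -big_split; apply: eq_bigr => i _ /=.
(* Equal parities [s] and [t] give the coefficient of $e_{kl}$, where $(-1)^{st}$ turns $-\mathrm i$
   into $\mathrm i$; unequal ones give that of $f_{kl}$. *)
rewrite !big_bool /xcoef /dcoef /eb /fb /sopp /=.
rewrite expr1 expr0 !mul1r mulN1r !mulNr -!scalerAl -!scalerAr scalerA i2 scaleN1r opprK.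
rewrite tcoefN mulrN opprK scalerDr !tcoefD !mulrDr [X in _ + _ + X]addrC.
exact: addrACA.
Qed.

End Operators.

(** * The image of the product under the homomorphism *)

Section Image.
Variables (C : numClosedFieldType) (M N n : nat).
Variable phi : {lrmorphism Uq C N -> PD C M N}.
Hypothesis phi_even : forall k l : 'I_N, phi (UF C (pos k) (pos l)) =
  - \sum_(a : sidx M) px C a l * pd C k a.
Hypothesis phi_odd : forall k l : 'I_N, phi (UF C (pos k) (neg l)) =
  'i *: \sum_(a : sidx M) px C a l * pd C k (sopp a).

Let J : finType := ('I_N + 'I_M)%type.
Definition Phi (u : tpow 'I_N (Uq C N) n) : tpow J (PD C M N) n :=
  temb 'I_M (tmap phi u).

Lemma PhiB : {morph Phi : u v / u - v}.
Proof. by move=> u v; rewrite /Phi !raddfB. Qed.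

HB.instance Definition _ := GRing.isZmodMorphism.Build _ _ Phi PhiB.

(** The prescribed values of [phi] are homogeneous of the same parity as the generators, which is
    what [tmap_tcoef] asks for. *)
Lemma phi_sgn k j : phi (sgn (UF C (pos k) j)) = sgn (phi (UF C (pos k) j)).
Proof.
rewrite (homogeneous_UF _ _) raddf_sign; case: j => -[] l /=.
  suff -> : sgn (phi (UF C (pos k) (neg l))) = (-1) ^+ true * phi (UF C (pos k) (neg l)) by [].
  rewrite phi_odd; apply/homogeneousZ/homogeneous_sum => a.
  have := homogeneousM (homogeneous_px C a l) (homogeneous_pd C k (sopp a)).
  by rewrite /= addbN addbb.
suff -> : sgn (phi (UF C (pos k) (pos l))) = (-1) ^+ false * phi (UF C (pos k) (pos l)) by [].
rewrite phi_even; apply/homogeneousN/homogeneous_sum => a.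
have := homogeneousM (homogeneous_px C a l) (homogeneous_pd C k a).
by rewrite addbb.
Qed.

Lemma Phi_tunit (r : 'I_n) b u :
  Phi (tunit _ r b * u) = tunit _ r (qinl 'I_M b) * Phi u.
Proof. by rewrite /Phi tmap_tunit temb_tunit. Qed.

Lemma Phi_tens1 (r : 'I_n) b k j u : Phi (tens1 r b (UF C (pos k) j) * u) =
  tunit _ r (qinl 'I_M b) * tcoef J n (phi (UF C (pos k) j)) * Phi u.
Proof.
rewrite tens1E -mulrA Phi_tunit -mulrA; congr (_ * _).
by rewrite /Phi tmap_tcoef ?temb_tcoef //; exact: phi_sgn.
Qed.

Lemma Phi_Gop (r : 'I_n) u : Phi (Gop C N r * u) = Xop C M N r * Dop C M N r * Phi u.
Proof.
rewrite Xop_Dop !mulr_suml raddf_sum; apply: eq_bigr => k _.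
rewrite !mulr_suml raddf_sum; apply: eq_bigr => l _ /=.
rewrite mulrBl PhiB !Phi_tens1 phi_odd phi_even tcoefN mulrN mulNr opprK.
by rewrite mulrDl.
Qed.

Lemma Phi_Tab (a b : 'I_n) u : (a < b)%N ->
  Phi (Tab C N a b * u) = TabJ C M N a b * Phi u.
Proof.
move=> ab; rewrite /Tab /TabJ big_pair3 big_bool /= -big_split.
rewrite !mulr_suml raddf_sum; apply: eq_bigr => k _.
rewrite -big_split !mulr_suml raddf_sum; apply: eq_bigr => l _ /=.
rewrite mulrBl PhiB !tens2E // tcoef1 !mulr1 -!mulrA !Phi_tunit.
by rewrite expr0 mul1r expr1 mulN1r mulrDl mulNr -!mulrA.
Qed.

Lemma Phi1 : Phi 1 = \prod_(r < n) projN C M N r.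
Proof. by rewrite /Phi tmap1 temb1. Qed.

(** Multiplicativity of [Phi] is available only for left multiplication by the given factors, so
    these are taken out from the left one at a time; the remaining [Phi 1] is the product of
    idempotents. *)
Lemma Phi_prod (s : seq 'I_n) : Phi (\prod_(b <- s) (Gop C N b + JM C N b)) =
  \prod_(b <- s) (Xop C M N b * Dop C M N b +
    \sum_(a < n | (a < b)%N) TabJ C M N a b) * \prod_(r < n) projN C M N r.
Proof.
elim: s => [|b s IH]; first by rewrite !big_nil mul1r Phi1.
rewrite !big_cons -[RHS]mulrA -IH !mulrDl raddfD /= Phi_Gop; congr (_ + _).
by rewrite !mulr_suml raddf_sum; apply: eq_bigr => a ab; exact: Phi_Tab.
Qed.

Lemma prod_normal_ordering : (0 < n)%N ->
  \prod_(b < n) (Xop C M N b * Dop C M N b +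
    \sum_(a < n | (a < b)%N) TabJ C M N a b) =
  \prod_(r < n) Xop C M N r * \prod_(r < n) Dop C M N r.
Proof.
case: n => // m _.
(* [inord] turns the families into sequences over the naturals; its default value beyond [m] is
   never reached, as all indices stay below [m.+1]. *)
pose X i := Xop C M N (inord i : 'I_m.+1); pose D i := Dop C M N (inord i : 'I_m.+1).
pose T i j := TabJ C M N (inord i : 'I_m.+1) (inord j).
pose S i j := commDX C M N (inord i : 'I_m.+1) (inord j).
have neq i j : (i < j)%N -> (j < m.+1)%N -> (inord i : 'I_m.+1) != inord j.
  move=> ij jm; rewrite -val_eqE /= !inordK ?(ltn_trans ij) //.
  by rewrite neq_ltn ij.
have XE : \prod_(r < m.+1) Xop C M N r = \prod_(0 <= i < m.+1) X i.
  by rewrite big_mkord; apply: eq_bigr => i _; rewrite /X inord_val.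
have DE : \prod_(r < m.+1) Dop C M N r = \prod_(0 <= i < m.+1) D i.
  by rewrite big_mkord; apply: eq_bigr => i _; rewrite /D inord_val.
rewrite XE DE -(@normal_ordering _ m.+1 X D T S) ?big_mkord.
- apply: eq_bigr => b _; rewrite /X /D !inord_val; congr (_ + _).
  (* The sum over [a < b] is rewritten as a sum over all of ['I_m.+1] with the condition [a < b]. *)
  rewrite big_mkord (big_ord_widen _ (fun a => T a b) (ltnW (ltn_ord b))).
  by apply: eq_bigr => a _; rewrite /T !inord_val.
- by move=> a b /andP [ab bm]; apply: Dop_anticomm; apply: neq.
- by move=> a b /andP [ab bm]; apply: Dop_Xop; apply: neq.
- by move=> a b /andP [ab bm]; apply: Dop_TabJ; apply: neq.
- move=> a c b /andP [ac cb] bm; apply: Dop_TabJ_anticomm; last exact: neq.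
  by rewrite eq_sym neq // (ltn_trans cb).
Qed.

End Image.

Theorem theorem4p1 (R : realType) (N M n : nat)
    (hN : (0 < N)%N) (hM : (0 < M)%N) (hn : (0 < n)%N)
    (phi : {lrmorphism Uq R[i] N -> PD R[i] M N})
    (phi_even : forall k l : 'I_N, phi (UF R[i] (pos k) (pos l)) =
       - \sum_(a : sidx M) px R[i] a l * pd R[i] k a)
    (phi_odd : forall k l : 'I_N, phi (UF R[i] (pos k) (neg l)) =
       'i%R *: \sum_(a : sidx M) px R[i] a l * pd R[i] k (sopp a)) :
  temb 'I_M (tmap phi (\prod_(b < n) (Gop R[i] N b + JM R[i] N b))) =
  (\prod_(r < n) Xop R[i] M N r) * (\prod_(r < n) Dop R[i] M N r).
Proof.
rewrite -/(Phi phi _) (Phi_prod phi_even phi_odd) (prod_normal_ordering _ _ _ hn).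
(* The idempotents left over by [Phi 1] stand to the right of the [Dop] and are absorbed. *)
by rewrite -mulrA prod_Dop_projN.
Qed.
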